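(* Let $q\ge 3$. There exists a constant $C^*(q)$, depending only on $q$, such that for every integer $d\ge 1$, every $p\in[0,1]$ with $\lambda = 1-\frac{pq}{q-1}\in[0,1]$, and every noise matrix $\Delta$ satisfying the two assumptions in the context: if $\lambda^2 d > C^*(q)$, then $$\lim_{m\to\infty} E_m = \lim_{m\to\infty}\tilde E_m .$$
   Context: Let $T$ be the infinite rooted tree with root $\rho$ in which every vertex has exactly $d$ children. Labels $\sigma_u\in[q]=\{1,\dots,q\}$ are generated as follows: $\sigma_\rho$ is uniform on $[q]$, and independently along each edge from a parent $u$ to a child $v$, $\mathbb P(\sigma_v=j\mid\sigma_u=i)=1-p$ if $i=j$ and $\frac{p}{q-1}$ if $i\ne j$. The second eigenvalue of this transition matrix is $\lambda=1-\frac{pq}{q-1}$. $L_m(u)$ denotes the set of vertices $m$ levels below $u$ in the subtree rooted at $u$. Noisy labels: given $\sigma$, the labels $\tau_u\in[q]$ are independent over vertices $u$ with $\mathbb P(\tau_u=j\mid\sigma_u=i)=\Delta_{ij}$, where $\Delta\in[0,1]^{q\times q}$ is a row-stochastic matrix satisfying the assumptions (1) $\sum_{i=1}^q\Delta_{ij}=1$ for all $j\in[q]$, and (2) $\Delta_{ii}\ge 1-\frac1q$ for all $i\in[q]$. Define the posteriors $X_\rho^{(m)}(i)=\mathbb P(\sigma_\rho=i\mid \sigma_{L_m(\rho)})$ and $W_\rho^{(m)}(i)=\mathbb P(\sigma_\rho=i\mid\tau_{L_m(\rho)})$, and the optimal recovery probabilities $E_m=\mathbb E[\max_i X_\rho^{(m)}(i)]$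 and $\tilde E_m=\mathbb E[\max_i W_\rho^{(m)}(i)]$ (the probabilities that the maximum likelihood estimate of $\sigma_\rho$ given $\sigma_{L_m(\rho)}$, respectively $\tau_{L_m(\rho)}$, is correct). *)

(* Defs.v *)
From HB Require Import structures.
From mathcomp Require Import all_boot all_order all_algebra.
From mathcomp Require Import all_classical all_reals all_analysis.

Set Implicit Arguments.
Unset Strict Implicit.
Unset Printing Implicit Defensive.

Import Order.TTheory GRing.Theory Num.Theory.
Import numFieldNormedType.Exports.

Local Open Scope classical_set_scope.
Local Open Scope ring_scope.

(* The label set [q] is 'I_q, with labels numbered from 0. *)

Definition potts_kernel (R : realType) (q : nat) (p : R) (i j : 'I_q) : R :=
  if i == j then 1 - p else p / (q%:R - 1).

Definition potts_eigenvalue (R : realType) (q : nat) (p : R) : R :=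
  1 - p * q%:R / (q%:R - 1).

Record noise_matrix (R : realType) (q : nat) (Delta : 'M[R]_q) : Prop :=
  NoiseMatrix {
    noise_entry : forall i j, 0 <= Delta i j <= 1 ;
    noise_row : forall i, \sum_(j < q) Delta i j = 1 ;
    noise_col : forall j, \sum_(i < q) Delta i j = 1 ;
    noise_diag : forall i, 1 - q%:R^-1 <= Delta i i }.

(* A vertex of the infinite d-ary tree is the word u : seq 'I_d of child indices
   read from the root [::]; the children of u are the words rcons u c, and the
   depth of u is size u. The vertices at depth k are the k.-tuples.

   [broadcast P p Delta sigma tau]: under P, sigma and tau are the labels and the
   noisy labels of the process on the infinite tree. Their joint law is given by
   its cylinder probabilities: the labelling (s, t) of the vertices of depth at
   most n has probability
     1/q * \prod_(edges u -> v) M (s u) (s v) * \prod_(vertices u) Delta (s u) (t u)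
   with M the Potts kernel, i.e. a uniform root label, independent transitions
   along the edges, and noisy labels independent given sigma. *)
Record broadcast (R : realType) (disp : measure_display)
    (T : measurableType disp) (P : probability T R) (q d : nat) (p : R)
    (Delta : 'M[R]_q) (sigma tau : seq 'I_d -> T -> 'I_q) : Prop :=
  Broadcast {
    label_measurable : forall u i, measurable [set w | sigma u w = i] ;
    noisy_measurable : forall u i, measurable [set w | tau u w = i] ;
    broadcast_law : forall (n : nat) (s t : seq 'I_d -> 'I_q),
      P [set w | forall u, (size u <= n)%N ->
                   sigma u w = s u /\ tau u w = t u] =
      (q%:R^-1
       * (\prod_(k < n) \prod_(u : k.-tuple 'I_d) \prod_(c < d)
            potts_kernel p (s u) (s (rcons u c)))
       * (\prod_(k < n.+1) \prod_(u : k.-tuple 'I_d) Delta (s u) (t u)))%:E }.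

Definition level (T : Type) (q d : nat) (lab : seq 'I_d -> T -> 'I_q)
    (m : nat) (w : T) : {ffun m.-tuple 'I_d -> 'I_q} :=
  [ffun u : m.-tuple 'I_d => lab u w].

(* P(Y = i | Z) for a random variable Z with finitely many values, as a random
   variable; its value on the null event P(Z = Z w) = 0 is 0. *)
Definition posterior (R : realType) (disp : measure_display)
    (T : measurableType disp) (P : probability T R) (q : nat) (F : finType)
    (Y : T -> 'I_q) (Z : T -> F) (i : 'I_q) (w : T) : R :=
  fine (P [set w' | Y w' = i /\ Z w' = Z w]) / fine (P [set w' | Z w' = Z w]).

(* The default 0 of the maximum is harmless since posteriors are nonnegative. *)
Definition recovery (R : realType) (disp : measure_display)
    (T : measurableType disp) (P : probability T R) (q : nat) (F : finType)
    (Y : T -> 'I_q) (Z : T -> F) : \bar R :=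
  expectation P (fun w => \big[Num.max/0]_(i < q) posterior P Y Z i w).

(* E_m for lab = sigma, and its noisy version for lab = tau. *)
Definition level_recovery (R : realType) (disp : measure_display)
    (T : measurableType disp) (P : probability T R) (q d : nat)
    (sigma lab : seq 'I_d -> T -> 'I_q) (m : nat) : \bar R :=
  recovery P (sigma [::]) (level lab m).

(* Main.v *)
Require Import Defs.
From HB Require Import structures.
From mathcomp Require Import all_boot all_order all_algebra.
From mathcomp Require Import all_classical all_reals all_analysis.
From mathcomp Require Import measurable_realfun ring lra zify.

Set Implicit Arguments.
Unset Strict Implicit.
Unset Printing Implicit Defensive.

Import Order.TTheory GRing.Theory Num.Theory.
Import numFieldNormedType.Exports.

Local Open Scope classical_set_scope.
Local Open Scope ring_scope.

(** Everything is finite.  An observation [x] made below a vertex is encoded by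
    its likelihood vector, whose [i]-th entry is the probability of [x] when the
    vertex has label [i]; normalizing it gives the posterior.  For the exact level
    [m] these vectors are [level_law root_leaf], for the noisy level they are
    [level_law (degrade Delta root_leaf)].  The noise acts on the level without
    looking at the root, so the noisy level is a degradation of the exact one.  With
    X and W the two posteriors, W is then the conditional expectation of X given
    the noisy level, and E|X - W|^2 = E|X|^2 - E|W|^2.  Up to the factor [q] this
    difference is [sqmass_loss] (lemma [sqmass_gap]), and the heart of the proof
    is that it tends to 0.

    The loss contracts from one level to the next.  A vertex sees [d] conditionally
    independent children; replacing their exact observations by the noisy ones one
    after the other is a chain of degradations, so the loss is the exact sum of
    [d] one-child losses ([replace_children]): no cross terms, hence a factor [d]
    and not [d ^ 2].  If the likelihood vector of the other [d - 1] children is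
    [v], replacing one child costs at most a constant times [lam ^ 2], times the
    loss of that child, times [overlap v] ([replace_one_child]).  The overlaps are
    Bhattacharyya coefficients, so they multiply over independent children, and
    the contraction ratio is at most a constant times
    [d * lam ^ 2 * (1 - lam) ^- 4 * b ^ (d - 1)], where [b] bounds the coefficient of
    one child ([sqmass_loss_contract]).

    It remains to bound [b].  The leaves distinguish any two labels by a constant
    amount in l1 distance, noise included; when [lam ^ 2 * d] is large this property
    reproduces itself from level to level, and [b <= 1 - lam ^ 2 / 18]
    ([child_overlap_le]).  This makes the ratio small as long as [1 - lam] is
    bounded below.  When [lam] is close to 1, the factor [(1 - lam) ^- 4] is
    beaten because after enough levels [b] is of order [sqrt (1 - lam)]
    ([level_overlap_near1]).  When [lam = 1] the overlaps themselves tend to 0, and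
    they bound the loss.

    Finally the two recovery probabilities differ by an amount controlled by the
    loss ([maxmass_gap]), and the exact one is nonincreasing in [m] because
    level [m + 1] is a degradation of level [m].  So both converge, to the same
    limit.  The law of the process enters only through [label_law] and
    [noisy_law], obtained by summing out the levels one at a time from the root. *)

(** * Likelihood vectors *)

Section Vectors.
Context {R : realType} {q : nat}.
Implicit Types u v : 'I_q -> R.

Definition mass v := \sum_i v i.

Definition normalize v : 'I_q -> R := fun i => v i / mass v.

(** Summed over all observations, [sqmass] is the expected squared Euclidean norm
    of the posterior under a uniform prior, times [q]. The value at the zero vector
    is 0, so impossible observations do not contribute. *)
Definition sqmass v := (\sum_i v i ^+ 2) / mass v.

Definition pmul u v : 'I_q -> R := fun i => u i * v i.

(** Summed over all observations, [overlap] gives the sum of the Bhattacharyya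
    coefficients of all ordered pairs of distinct labels. *)
Definition overlap v := \sum_i \sum_(j | j != i) Num.sqrt (v i * v j).

Definition nonneg v := forall i, 0 <= v i.

Lemma mass_ge0 v : nonneg v -> 0 <= mass v.
Proof. by move=> v0; apply: sumr_ge0. Qed.

Lemma le_mass v i : nonneg v -> v i <= mass v.
Proof. by move=> v0; rewrite /mass (bigD1 i)//= lerDl sumr_ge0. Qed.

Lemma mass0P v i : nonneg v -> mass v = 0 -> v i = 0.
Proof. by move=> v0 m0; apply/le_anti; rewrite v0 -m0 le_mass. Qed.

Lemma mass_normalize v i : nonneg v -> mass v * normalize v i = v i.
Proof.
move=> v0; rewrite /normalize; have [m0|m0] := eqVneq (mass v) 0.
  by rewrite m0 mul0r (mass0P i v0 m0).
by rewrite mulrCA mulfV// mulr1.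
Qed.

Lemma nonneg_normalize v : nonneg v -> nonneg (normalize v).
Proof. by move=> v0 i; rewrite divr_ge0// mass_ge0. Qed.

Lemma nonneg_pmul u v : nonneg u -> nonneg v -> nonneg (pmul u v).
Proof. by move=> u0 v0 i; exact: mulr_ge0. Qed.

Lemma overlap_ge0 v : 0 <= overlap v.
Proof. by apply: sumr_ge0 => i _; apply: sumr_ge0 => j _; exact: sqrtr_ge0. Qed.

Lemma sqmassE v : sqmass v = \sum_i v i * normalize v i.
Proof.
by rewrite /sqmass mulr_suml; apply: eq_bigr => i _; rewrite expr2 mulrA.
Qed.

End Vectors.

(** * Degradation of an observation *)

Section Degradation.
Context {R : realType} {q : nat} {F G : finType}.

(** Likelihoods of [y], when [x] is first observed and then only [y], drawn from
    [D x], is revealed. *)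
Definition degrade (D : F -> G -> R) (f : F -> 'I_q -> R) (y : G) (i : 'I_q) :=
  \sum_x D x y * f x i.

Definition stochastic (D : F -> G -> R) :=
  (forall x y, 0 <= D x y) /\ (forall x, \sum_y D x y = 1).

Lemma mass_degrade (D : F -> G -> R) f y :
  mass (degrade D f y) = \sum_x D x y * mass (f x).
Proof.
by rewrite /mass exchange_big; apply: eq_bigr => x _; rewrite mulr_sumr.
Qed.

Lemma nonneg_degrade (D : F -> G -> R) f y :
  stochastic D -> (forall x, nonneg (f x)) -> nonneg (degrade D f y).
Proof.
move=> [D0 _] f0 i; apply: sumr_ge0 => x _; exact: mulr_ge0 (D0 _ _) (f0 _ _).
Qed.

Lemma sum_degrade (D : F -> G -> R) (h : F -> R) :
  stochastic D -> \sum_x \sum_y D x y * h x = \sum_x h x.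
Proof.
by move=> [_ D1]; apply: eq_bigr => x _; rewrite -mulr_suml D1 mul1r.
Qed.

(** Pythagoras: the posterior given [y] is the conditional expectation, given [y],
    of the posterior given [x].  Hence the mean square drops by exactly the mean
    squared distance of the two posteriors; in the sum the cross term
    [normalize (f x) * normalize (degrade D f y)] averages to the mean square of the
    second posterior. *)
Lemma sqmass_gap (D : F -> G -> R) (f : F -> 'I_q -> R) :
  stochastic D -> (forall x, nonneg (f x)) ->
  \sum_x sqmass (f x) - \sum_y sqmass (degrade D f y) =
  \sum_x \sum_y D x y * (mass (f x) *
     \sum_i (normalize (f x) i - normalize (degrade D f y) i) ^+ 2).
Proof.
move=> DS f0; set g := degrade D f.
have g0 y : nonneg (g y) by exact: nonneg_degrade.
have -> : \sum_x \sum_y D x y * (mass (f x) *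
     \sum_i (normalize (f x) i - normalize (g y) i) ^+ 2) =
  \sum_x \sum_y D x y * sqmass (f x)
  - (\sum_x \sum_y \sum_i D x y * f x i * normalize (g y) i) *+ 2
  + \sum_x \sum_y \sum_i D x y * mass (f x) * normalize (g y) i ^+ 2.
  rewrite -sumrMnl -sumrB -big_split/=; apply: eq_bigr => x _.
  rewrite -sumrMnl -sumrB -big_split/=; apply: eq_bigr => y _.
  rewrite sqmassE -sumrMnl mulr_sumr -sumrB -big_split/= mulr_sumr mulr_sumr.
  apply: eq_bigr => i _; rewrite -{1 2}(mass_normalize i (f0 x)); ring.
have -> : \sum_x \sum_y \sum_i D x y * f x i * normalize (g y) i =
          \sum_y sqmass (g y).
  rewrite exchange_big; apply: eq_bigr => y _; rewrite exchange_big sqmassE.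
  by apply: eq_bigr => i _; rewrite -mulr_suml.
have -> : \sum_x \sum_y \sum_i D x y * mass (f x) * normalize (g y) i ^+ 2 =
          \sum_y sqmass (g y).
  rewrite exchange_big; apply: eq_bigr => y _; rewrite exchange_big sqmassE.
  apply: eq_bigr => i _; rewrite -mulr_suml -mass_degrade expr2 mulrA.
  by rewrite mass_normalize.
rewrite sum_degrade//; ring.
Qed.

End Degradation.

(** * The cost of changing the likelihoods of one child *)

Section EdgeChannel.
Context {R : realType} {q : nat}.
Implicit Types (u v : 'I_q -> R) (lam : R).

(** Likelihoods at a vertex of an observation below one of its children, in
    terms of the likelihoods at the child: with [lam] the eigenvalue, the child copies
    its parent with probability [lam] and is otherwise uniform. *)
Definition edge lam v : 'I_q -> R := fun i => lam * v i + (1 - lam) / q%:R * mass v.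

Lemma nonneg_edge lam v : 0 <= lam <= 1 -> nonneg v -> nonneg (edge lam v).
Proof.
move=> /andP[l0 l1] v0 i; rewrite addr_ge0// mulr_ge0 ?mass_ge0//.
by rewrite divr_ge0 ?subr_ge0.
Qed.

(** Both factors are at most the mass, so their geometric mean is too. *)
Lemma mul_div_mass_le v i j :
  nonneg v -> v i * v j / mass v <= Num.sqrt (v i * v j).
Proof.
move=> v0; have [m0|m0] := eqVneq (mass v) 0.
  by rewrite m0 invr0 mulr0 sqrtr_ge0.
have S0 := mass_ge0 v0.
rewrite ler_pdivrMr ?lt_def ?m0//.
have {1}-> : v i * v j = Num.sqrt (v i * v j) ^+ 2.
  by rewrite sqr_sqrtr// mulr_ge0.
rewrite expr2 ler_wpM2l ?sqrtr_ge0//.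
rewrite -(ger0_norm S0) -sqrtr_sqr ler_wsqrtr// expr2.
by rewrite ler_pM// le_mass.
Qed.

(** Per unit of mass, the left side is the probability that two independent draws
    from the posterior differ. *)
Lemma mass_sub_sqmass v : nonneg v -> mass v - sqmass v <= overlap v.
Proof.
move=> v0; rewrite sqmassE {1}/mass -sumrB; apply: ler_sum => i _.
have [m0|m0] := eqVneq (mass v) 0.
  by rewrite (mass0P i v0 m0) mul0r subr0 sumr_ge0// => j _; exact: sqrtr_ge0.
rewrite (_ : v i - _ = \sum_(j | j != i) v i * v j / mass v); last first.
  rewrite -mulr_suml -mulr_sumr.
  have -> : \sum_(j | j != i) v j = mass v - v i.
    by rewrite /mass [in RHS](bigD1 i)//=; ring.
  by rewrite /normalize; field.
by apply: ler_sum => j _; exact: mul_div_mass_le.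
Qed.

(** The posteriors of the products [v F] and [v G] differ in coordinate [i] by
    [\sum_j v i * v j * (F i * G j - G i * F j)] over the product of the two masses.
    The term [j = i] vanishes, so a pair [i != j] is always charged [v i * v j], which
    is small when [v] nearly determines the label. The lower bound [k] keeps the masses
    away from 0. *)
Lemma mass_normalize_gap v (F G : 'I_q -> R) (k : R) :
  0 < k -> nonneg v ->
  (forall i, k <= F i) -> (forall i, k <= G i) ->
  (forall i, F i <= 1) -> (forall i, G i <= 1) ->
  mass (pmul v F) * \sum_i (normalize (pmul v F) i - normalize (pmul v G) i) ^+ 2
  <= 4 / k ^+ 4 * (\sum_i (F i - G i) ^+ 2) * overlap v.
Proof.
move=> k0 v0 kF kG F1 G1.
set H := \sum_i (F i - G i) ^+ 2.
have H0 : 0 <= H by apply: sumr_ge0 => i _; exact: sqr_ge0.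
have k0' := ltW k0.
have c0 : 0 <= 4 / k ^+ 4 * H by rewrite mulr_ge0// divr_ge0// exprn_ge0.
have F0 i : 0 <= F i by exact: le_trans (ltW k0) (kF i).
have G0 i : 0 <= G i by exact: le_trans (ltW k0) (kG i).
set S := mass v; have S0 : 0 <= S by exact: mass_ge0.
have [Sz|Sn] := eqVneq S 0.
  have vz i : v i = 0 by exact: mass0P.
  rewrite {1}/mass big1 ?mul0r; first exact: mulr_ge0 c0 (overlap_ge0 _).
  by move=> i _; rewrite /pmul vz mul0r.
have Sp : 0 < S by rewrite lt_def Sn.
have SE (E : 'I_q -> R) : (forall i, k <= E i) -> k * S <= mass (pmul v E).
  move=> kE; rewrite /S /mass mulr_sumr; apply: ler_sum => i _.
  by rewrite /pmul mulrC ler_wpM2l.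
have SF := SE _ kF; have SG := SE _ kG.
have kS : 0 < k * S by exact: mulr_gt0.
set f := mass (pmul v F) in SF *; set g := mass (pmul v G) in SG *.
have fp : 0 < f by exact: lt_le_trans SF.
have gp : 0 < g by exact: lt_le_trans SG.
have fS : f <= S.
  by apply: ler_sum => i _; rewrite /pmul -[leRHS]mulr1 ler_wpM2l.
have h2 i : `|F i - G i| <= Num.sqrt H.
  rewrite -sqrtr_sqr; apply: ler_wsqrtr.
  by rewrite /H (bigD1 i)//= lerDl sumr_ge0// => j _; exact: sqr_ge0.
set T := fun i => \sum_(j | j != i) v i * v j.
have T0 i : 0 <= T i by apply: sumr_ge0 => j _; exact: mulr_ge0.
have TS i : T i <= S ^+ 2.
  rewrite /T -mulr_sumr expr2; apply: ler_pM => //; last 1 first.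
  - by rewrite /S /mass [leRHS](bigD1 i)//= lerDr.
  - by apply: sumr_ge0.
  - exact: le_mass.
have num i : `|normalize (pmul v F) i - normalize (pmul v G) i|
    <= 2 * Num.sqrt H * T i / (k * S) ^+ 2.
  have -> : normalize (pmul v F) i - normalize (pmul v G) i =
            (\sum_(j | j != i) v i * v j * (F i * G j - G i * F j)) / (f * g).
    rewrite /normalize -/f -/g /pmul.
    have -> : \sum_(j | j != i) v i * v j * (F i * G j - G i * F j) =
              v i * F i * g - v i * G i * f.
      rewrite /f /g /mass /pmul !mulr_sumr -sumrB [RHS](bigD1 i)//=.
      rewrite [X in _ = X + _](_ : _ = 0) ?add0r; last by ring.
      by apply: eq_bigr => j _; ring.
    by field; rewrite !gt_eqF.
  rewrite normrM normfV (gtr0_norm (mulr_gt0 fp gp)).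
  apply: ler_pM => //.
  - by rewrite invr_ge0 mulr_ge0 ?ltW.
  - apply: (le_trans (ler_norm_sum _ _ _)); rewrite /T mulr_sumr.
    apply: ler_sum => j _; rewrite normrM ger0_norm ?mulr_ge0// mulrC.
    rewrite ler_wpM2r ?mulr_ge0//.
    have -> : F i * G j - G i * F j = (F i - G i) * G j - G i * (F j - G j) by ring.
    apply: (le_trans (ler_normB _ _)); rewrite !normrM !(ger0_norm (G0 _)).
    have := h2 i; have := h2 j => hj hi.
    rewrite mulr2n mulrDl mul1r; apply: lerD.
      by rewrite -[leRHS]mulr1 ler_pM.
    by rewrite -[leRHS]mul1r ler_pM.
  - by rewrite lef_pV2 ?posrE ?exprn_gt0// ?mulr_gt0// expr2 ler_pM// ltW.
have num2 i : (normalize (pmul v F) i - normalize (pmul v G) i) ^+ 2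
    <= 4 / k ^+ 4 * H * (T i / S ^+ 2).
  rewrite -real_normK ?num_real//.
  apply: (le_trans (lerXn2r _ _ _ (num i))); rewrite ?nnegrE//.
    by rewrite divr_ge0 ?mulr_ge0 ?sqrtr_ge0 ?exprn_ge0// ltW.
  rewrite !exprMn sqr_sqrtr// exprVn.
  have -> : 2 ^+ 2 * H * T i ^+ 2 * ((k ^+ 2 * S ^+ 2) ^+ 2)^-1 =
            4 / k ^+ 4 * H * (T i / S ^+ 2) * (T i / S ^+ 2).
    by field; rewrite ?Sn gt_eqF.
  rewrite -[leRHS]mulr1 ler_wpM2l//.
    by rewrite mulr_ge0// divr_ge0// exprn_ge0.
  by rewrite ler_pdivrMr ?exprn_gt0// mul1r.
apply: (@le_trans _ _ (S * (\sum_i 4 / k ^+ 4 * H * (T i / S ^+ 2)))).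
  apply: ler_pM => //; first exact: ltW.
    by apply: sumr_ge0 => i _; exact: sqr_ge0.
  by apply: ler_sum => i _.
rewrite -mulr_sumr mulrCA ler_wpM2l// -mulr_suml mulrC.
have -> : (\sum_i T i) / S ^+ 2 * S = \sum_i T i / S.
  by rewrite -mulr_suml; field.
apply: ler_sum => i _; rewrite /T mulr_suml; apply: ler_sum => j _.
exact: mul_div_mass_le.
Qed.

End EdgeChannel.

(** * Replacing one child by a degraded one *)

Section Scaling.
Context {R : realType} {q : nat}.
Implicit Types (u v : 'I_q -> R) (c : R).

Lemma mass_scale c v : mass (fun i => c * v i) = c * mass v.
Proof. by rewrite /mass mulr_sumr. Qed.

Lemma normalize_scale c v i : c != 0 -> normalize (fun i => c * v i) i = normalize v i.
Proof. by move=> c0; rewrite /normalize mass_scale -mulf_div mulfV// mul1r. Qed.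

Lemma normalize_le1 v i : nonneg v -> normalize v i <= 1.
Proof.
move=> v0; have [m0|m0] := eqVneq (mass v) 0.
  by rewrite /normalize m0 invr0 mulr0.
by rewrite ler_pdivrMr ?mul1r ?le_mass// lt_def m0 mass_ge0.
Qed.

End Scaling.

Section OneChild.
Context {R : realType} {q : nat} {F G : finType}.

Lemma degrade_edge (D : F -> G -> R) (mu : F -> 'I_q -> R) lam y :
  degrade D (fun x => edge lam (mu x)) y = edge lam (degrade D mu y).
Proof.
apply/funext => i; rewrite /edge mass_degrade /degrade !mulr_sumr -big_split/=.
by apply: eq_bigr => x _; ring.
Qed.

Lemma degrade_pmul (D : F -> G -> R) (f : F -> 'I_q -> R) v y :
  degrade D (fun x => pmul v (f x)) y = pmul v (degrade D f y).
Proof.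
apply/funext => i; rewrite /degrade /pmul mulr_sumr.
by apply: eq_bigr => x _; ring.
Qed.

(** Here [v] is the likelihood vector of the other children.  By [sqmass_gap] both
    losses are averages of squared distances of posteriors over the same pairs
    [(x, y)], and the two averages are compared pair by pair with
    [mass_normalize_gap]; the lower bound is [(1 - lam) / q], the least value of the
    normalized vector after crossing the edge.  The edge shrinks differences of
    posteriors by [lam]. *)
Lemma replace_one_child (D : F -> G -> R) (mu : F -> 'I_q -> R) (lam : R)
    (v : 'I_q -> R) :
  (0 < q)%N -> 0 <= lam < 1 -> stochastic D -> (forall x, nonneg (mu x)) ->
  nonneg v ->
  \sum_x sqmass (pmul v (edge lam (mu x)))
  - \sum_y sqmass (pmul v (edge lam (degrade D mu y)))
  <= 4 * lam ^+ 2 / ((1 - lam) / q%:R) ^+ 4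
     * (\sum_x sqmass (mu x) - \sum_y sqmass (degrade D mu y)) * overlap v.
Proof.
move=> q0 /andP[l0 l1] DS mu0 v0.
have lam01 : 0 <= lam <= 1 by rewrite l0 ltW.
have kn0 x : nonneg (edge lam (mu x)) by exact: nonneg_edge.
under [X in _ - X]eq_bigr do rewrite -degrade_edge -degrade_pmul.
rewrite sqmass_gap// sqmass_gap//; last by move=> x; exact: nonneg_pmul.
set k := (1 - lam) / q%:R.
have k0 : 0 < k by rewrite divr_gt0 ?subr_gt0// ltr0n.
have kl : lam + k <= 1.
  rewrite -lerBrDl /k ler_pdivrMr ?ltr0n// ler_peMr ?subr_ge0 ?(ltW l1)//.
  by rewrite ler1n.
rewrite mulrAC mulr_sumr; apply: ler_sum => x _.
rewrite mulr_sumr; apply: ler_sum => y _.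
rewrite [leRHS]mulrCA; have [D0 D1] := DS.
(* A pair with [D x y = 0] never occurs; otherwise [x] and [y] both have
   positive mass, or [x] is impossible. *)
have [Dz|Dn] := eqVneq (D x y) 0; first by rewrite Dz !mul0r.
rewrite ler_wpM2l//.
set m := mass (mu x).
have [mz|mn] := eqVneq m 0.
  rewrite mz mul0r mulr0 [mass _](_ : _ = 0) ?mul0r//.
  rewrite /mass big1// => i _.
  by rewrite /pmul /edge -/m mz (mass0P i (mu0 x) mz) !mulr0 addr0 mulr0.
have mp : 0 < m by rewrite lt_def mn mass_ge0.
have N0 : nonneg (degrade D mu y) by exact: nonneg_degrade.
set M := mass (degrade D mu y).
have Mp : 0 < M.
  rewrite /M mass_degrade (bigD1 x)//= ltr_pwDl//.
    by rewrite mulr_gt0// lt_def Dn D0.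
  by apply: sumr_ge0 => z _; rewrite mulr_ge0 ?mass_ge0.
(* Taking out the masses leaves vectors with entries in the interval from [k] to 1. *)
pose P i := lam * normalize (mu x) i + k.
pose Q i := lam * normalize (degrade D mu y) i + k.
have PE : pmul v (edge lam (mu x)) = (fun i => m * pmul v P i).
  apply/funext => i; rewrite /pmul /P /edge -(mass_normalize i (mu0 x)) -/m.
  by rewrite -/k; ring.
have QE : pmul v (edge lam (degrade D mu y)) = (fun i => M * pmul v Q i).
  apply/funext => i; rewrite /pmul /Q /edge -(mass_normalize i N0) -/M.
  by rewrite -/k; ring.
rewrite degrade_pmul degrade_edge PE QE mass_scale.
under eq_bigr do rewrite !normalize_scale ?gt_eqF//.
have lP (w : 'I_q -> R) i : nonneg w -> k <= lam * normalize w i + k <= 1.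
  move=> w0; rewrite lerDr mulr_ge0//=; last exact: nonneg_normalize.
  apply: le_trans kl; rewrite lerD2r -[leRHS]mulr1 ler_wpM2l//.
  exact: normalize_le1.
rewrite -mulrA (_ : 4 * _ / _ * _ * _ =
   m * (4 / k ^+ 4 * (\sum_i (P i - Q i) ^+ 2) * overlap v)).
  rewrite ler_wpM2l ?(ltW mp)//; apply: mass_normalize_gap => // i.
  - by case/andP: (lP _ i (mu0 x)).
  - by case/andP: (lP _ i N0).
  - by case/andP: (lP _ i (mu0 x)).
  - by case/andP: (lP _ i N0).
have -> : \sum_i (P i - Q i) ^+ 2 = lam ^+ 2 *
    \sum_i (normalize (mu x) i - normalize (degrade D mu y) i) ^+ 2.
  by rewrite mulr_sumr; apply: eq_bigr => i _; rewrite /P /Q; ring.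
ring.
Qed.

End OneChild.

(** * Replacing all children *)

Section Averaging.
Context {R : realType} {q : nat}.
Implicit Types (v : 'I_q -> R) (psi : ('I_q -> R) -> R).

(** The operator that observes one more child, with likelihoods [f], and averages
    the functional [psi] of the accumulated vector [v].  Observing several children is
    iteration, and operators for different children commute. *)
Definition absorb (F : finType) (f : F -> 'I_q -> R) psi v : R :=
  \sum_x psi (pmul v (f x)).

Lemma absorbC (F G : finType) (f : F -> 'I_q -> R) (g : G -> 'I_q -> R) psi :
  absorb f (absorb g psi) = absorb g (absorb f psi).
Proof.
apply/funext => v; rewrite /absorb exchange_big; apply: eq_bigr => y _.
apply: eq_bigr => x _; congr psi; apply/funext => i; rewrite /pmul; ring.
Qed.

Lemma absorb_iterC (F G : finType) (f : F -> 'I_q -> R) (g : G -> 'I_q -> R) n psi :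
  absorb f (iter n (absorb g) psi) = iter n (absorb g) (absorb f psi).
Proof. by elim: n => //= n <-; rewrite absorbC. Qed.

Definition sqrt_overlap (F : finType) (f : F -> 'I_q -> R) (i j : 'I_q) : R :=
  \sum_x Num.sqrt (f x i * f x j).

(** Bhattacharyya coefficients multiply under independent observations. *)
Lemma absorb_overlap (F : finType) (f : F -> 'I_q -> R) (b : R) v :
  (forall x, nonneg (f x)) -> (forall i j, i != j -> sqrt_overlap f i j <= b) ->
  nonneg v -> absorb f overlap v <= b * overlap v.
Proof.
move=> f0 fb v0; rewrite /absorb /overlap exchange_big mulr_sumr.
apply: ler_sum => i _; rewrite exchange_big mulr_sumr; apply: ler_sum => j ji.
rewrite (eq_bigr (fun x => Num.sqrt (v i * v j) * Num.sqrt (f x i * f x j))).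
  by rewrite -mulr_sumr mulrC ler_wpM2r ?sqrtr_ge0// fb// eq_sym.
by move=> x _; rewrite -sqrtrM ?mulr_ge0//; congr Num.sqrt; rewrite /pmul; ring.
Qed.

Lemma iter_absorb_overlap (F : finType) (f : F -> 'I_q -> R) (b : R) n psi (c : R) v :
  (forall x, nonneg (f x)) -> 0 <= b ->
  (forall i j, i != j -> sqrt_overlap f i j <= b) ->
  0 <= c -> (forall u, nonneg u -> psi u <= c * overlap u) ->
  nonneg v -> iter n (absorb f) psi v <= c * b ^+ n * overlap v.
Proof.
move=> f0 b0 fb c0 psic; elim: n v => [|n IH] v v0 /=.
  by rewrite expr0 mulr1 psic.
apply: (@le_trans _ _ (c * b ^+ n * absorb f overlap v)).
  rewrite {1 2}/absorb mulr_sumr; apply: ler_sum => x _; apply: IH.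
  exact: nonneg_pmul.
rewrite exprS -!mulrA ler_wpM2l//.
by rewrite mulrCA ler_wpM2l ?exprn_ge0// absorb_overlap.
Qed.

Lemma iter_absorb_sub (G : finType) (g : G -> 'I_q -> R) n psi1 psi2 v :
  iter n (absorb g) (fun u => psi1 u - psi2 u) v =
  iter n (absorb g) psi1 v - iter n (absorb g) psi2 v.
Proof. by elim: n v => //= n IH v; rewrite /absorb -sumrB; apply: eq_bigr. Qed.

(** Telescoping over the [n] children.  In each step one operator [absorb f] is
    exchanged for [absorb g]; the other [n - 1] operators are positive, so they may be
    applied to the pointwise bound [c * overlap], and each contributes a factor
    [b]. *)
Lemma replace_children (F G : finType) (f : F -> 'I_q -> R) (g : G -> 'I_q -> R)
    psi (b c : R) n v :
  (forall x, nonneg (f x)) -> (forall y, nonneg (g y)) -> 0 <= b -> 0 <= c ->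
  (forall i j, i != j -> sqrt_overlap f i j <= b) ->
  (forall i j, i != j -> sqrt_overlap g i j <= b) ->
  (forall u, nonneg u -> absorb f psi u - absorb g psi u <= c * overlap u) ->
  nonneg v ->
  iter n (absorb f) psi v - iter n (absorb g) psi v <=
  n%:R * (c * b ^+ n.-1) * overlap v.
Proof.
move=> f0 g0 b0 c0 fb gb fg; elim: n v => [|n IH] v v0 /=.
  by rewrite subrr !mul0r.
(* First exchange the [n] inner operators, then the outer one, which commutes with
   the inner operators [absorb g]. *)
rewrite -(subrKA (absorb f (iter n (absorb g) psi) v)) -natr1 mulrDl mul1r mulrDl.
apply: lerD.
  apply: (@le_trans _ _ (n%:R * (c * b ^+ n.-1) * absorb f overlap v)).
    rewrite {1 2 4}/absorb -sumrB mulr_sumr; apply: ler_sum => x _; apply: IH.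
    exact: nonneg_pmul.
  apply: (@le_trans _ _ (n%:R * (c * b ^+ n.-1) * (b * overlap v))).
    by rewrite ler_wpM2l ?absorb_overlap// !mulr_ge0// exprn_ge0.
  case: n {IH} => [|n]; first by rewrite !mul0r.
  by rewrite /= exprS le_eqVlt; apply/orP; left; apply/eqP; ring.
have -> : absorb g (iter n (absorb g) psi) = iter n (absorb g) (absorb g psi).
  by rewrite -iterS iterSr.
rewrite absorb_iterC -iter_absorb_sub.
exact: iter_absorb_overlap.
Qed.

Lemma sum_ffunS (F : finType) n (h : {ffun 'I_n.+1 -> F} -> R) :
  \sum_s h s = \sum_x \sum_(s : {ffun 'I_n -> F})
     h [ffun c => if unlift ord0 c is Some c' then s c' else x].
Proof.
rewrite pair_big/=.
pose glue (p : F * {ffun 'I_n -> F}) : {ffun 'I_n.+1 -> F} :=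
  [ffun c => if unlift ord0 c is Some c' then p.2 c' else p.1].
rewrite (reindex glue)//=.
exists (fun s => (s ord0, [ffun c => s (lift ord0 c)])) => [[x s]|s] _.
  rewrite /glue/= ffunE unlift_none; congr pair.
  by apply/ffunP => c; rewrite !ffunE liftK.
apply/ffunP => c; rewrite !ffunE/=.
by case: unliftP => [j ->|->] //=; rewrite ffunE.
Qed.

Lemma iter_absorbE (F : finType) (f : F -> 'I_q -> R) n psi v :
  iter n (absorb f) psi v =
  \sum_(s : {ffun 'I_n -> F}) psi (fun i => v i * \prod_(c < n) f (s c) i).
Proof.
elim: n v => [|n IH] v /=.
  rewrite (big_pred1 [ffun c : 'I_0 => False_rect F (notF (ltn_ord c))]).
    by congr psi; apply/funext => i; rewrite big_ord0 mulr1.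
  by move=> s; apply/esym/eqP/ffunP => -[].
rewrite /absorb sum_ffunS; apply: eq_bigr => x _; rewrite IH; apply: eq_bigr => s _.
congr psi; apply/funext => i; rewrite big_ord_recl !ffunE unlift_none /pmul mulrA.
by congr (_ * _); apply: eq_bigr => c _; rewrite ffunE liftK.
Qed.

End Averaging.

(** * Recursive structure of the levels of the tree *)

Section Currying.
Context {R : realType} {T1 T2 T : finType} (f : T1 -> T2 -> T).

Definition curry_ffun (L : Type) (x : {ffun T -> L}) : {ffun T1 -> {ffun T2 -> L}} :=
  [ffun a => [ffun b => x (f a b)]].

Lemma sum_curry (L : finType) (h : {ffun T1 -> {ffun T2 -> L}} -> R) :
  bijective (fun p => f p.1 p.2) ->
  \sum_(x : {ffun T -> L}) h (curry_ffun x) = \sum_s h s.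
Proof.
case=> g fK gK; rewrite [RHS](reindex (@curry_ffun L))//.
exists (fun s : {ffun T1 -> {ffun T2 -> L}} =>
  [ffun t => s (g t).1 (g t).2]) => [x|s] _.
  by apply/ffunP => t; rewrite !ffunE gK.
apply/ffunP => a; rewrite ffunE; apply/ffunP => b.
by rewrite !ffunE (fK (a, b)).
Qed.

Lemma prod_curry (h : T -> R) : bijective (fun p => f p.1 p.2) ->
  \prod_t h t = \prod_a \prod_b h (f a b).
Proof.
move=> [g fK gK]; rewrite pair_big/= (reindex (fun p => f p.1 p.2))//.
by exists g => x _; [exact: fK | exact: gK].
Qed.

End Currying.

Section TupleSplitting.
Context (m d : nat).

Lemma cons_tuple_bij :
  bijective (fun p : 'I_d * m.-tuple 'I_d => cons_tuple p.1 p.2).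
Proof.
apply: inj_card_bij; last by rewrite card_prod !card_tuple expnS card_ord.
move=> [c u] [c' u'] /(congr1 val)/= [-> e]; congr pair; exact: val_inj.
Qed.

Lemma rcons_tuple_bij :
  bijective (fun p : m.-tuple 'I_d * 'I_d => rcons_tuple p.1 p.2).
Proof.
apply: inj_card_bij; last by rewrite card_prod !card_tuple expnSr card_ord.
move=> [u c] [u' c'] /(congr1 val)/= /rcons_inj[e ->]; congr pair; exact: val_inj.
Qed.

End TupleSplitting.

Lemma tuple0_big (R : realType) (T : finType) (idx : R) (op : Monoid.com_law idx)
  (h : 0.-tuple T -> R) : \big[op/idx]_u h u = h [tuple].
Proof.
by rewrite (big_pred1 [tuple])// => u; apply/esym/eqP; exact: tuple0.
Qed.

Lemma sum_ffun_tuple0 (R : realType) (T L : finType) (h : L -> R) :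
  \sum_(x : {ffun 0.-tuple T -> L}) h (x [tuple]) = \sum_a h a.
Proof.
rewrite [RHS](reindex (fun x : {ffun 0.-tuple T -> L} => x [tuple]))//.
exists (fun a => [ffun=> a]) => [x|a] _; last by rewrite ffunE.
by apply/ffunP => u; rewrite ffunE; congr (x _); exact/esym/tuple0.
Qed.

Section Tree.
Context {R : realType} {q : nat} (d : nat) (lam : R).

Definition branch m (L : finType) (x : {ffun m.+1.-tuple 'I_d -> L}) (c : 'I_d) :
  {ffun m.-tuple 'I_d -> L} := curry_ffun (@cons_tuple m 'I_d) x c.

(** Likelihoods at the root of an observation of level [m], where [om] gives the
    likelihoods of what is seen at one leaf: given the root, the [d] subtrees of
    its children are independent. *)
Fixpoint level_law (L : finType) (om : L -> 'I_q -> R) m :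
    {ffun m.-tuple 'I_d -> L} -> 'I_q -> R :=
  match m with
  | 0 => fun x => om (x [tuple])
  | m'.+1 => fun x i => \prod_(c < d) edge lam (level_law om (branch x c)) i
  end.

Definition leafwise m (L L' : finType) (D : L -> L' -> R)
  (x : {ffun m.-tuple 'I_d -> L}) (y : {ffun m.-tuple 'I_d -> L'}) : R :=
  \prod_u D (x u) (y u).

Lemma stochastic_leafwise m (L L' : finType) (D : L -> L' -> R) :
  stochastic D -> stochastic (leafwise (m := m) D).
Proof.
move=> [D0 D1]; split=> [x y|x]; first by apply: prodr_ge0 => u _; exact: D0.
by rewrite /leafwise -(bigA_distr_bigA (fun u b => D (x u) b)) big1.
Qed.

Lemma leafwiseS m (L L' : finType) (D : L -> L' -> R) x y :
  leafwise (m := m.+1) D x y =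
  \prod_(c < d) leafwise (m := m) D (branch x c) (branch y c).
Proof.
rewrite /leafwise (prod_curry _ (cons_tuple_bij m d)); apply: eq_bigr => c _.
by apply: eq_bigr => u _; rewrite /branch !ffunE.
Qed.

Lemma sum_branch m (L : finType) (h : {ffun 'I_d -> {ffun m.-tuple 'I_d -> L}} -> R) :
  \sum_(x : {ffun m.+1.-tuple 'I_d -> L}) h (curry_ffun (@cons_tuple m 'I_d) x) =
  \sum_s h s.
Proof. exact/sum_curry/cons_tuple_bij. Qed.

Lemma prod_sum_branch m (L : finType) (h : 'I_d -> {ffun m.-tuple 'I_d -> L} -> R) :
  \prod_c \sum_x h c x =
  \sum_(x : {ffun m.+1.-tuple 'I_d -> L}) \prod_c h c (branch x c).
Proof. by rewrite bigA_distr_bigA/= -sum_branch. Qed.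

(** Noise at the leaves commutes with the passage from the leaves to the root. *)
Lemma level_law_degrade m (L L' : finType) (D : L -> L' -> R) (om : L -> 'I_q -> R) :
  level_law (degrade D om) (m := m) = degrade (leafwise D) (level_law om (m := m)).
Proof.
elim: m => [|m IH]; apply/funext => y; apply/funext => i /=.
  rewrite {2}/degrade/= /leafwise.
  under eq_bigr do rewrite tuple0_big.
  by rewrite (sum_ffun_tuple0 _ (fun a => D a (y [tuple]) * om a i)).
rewrite IH.
under eq_bigr do rewrite -degrade_edge {1}/degrade.
rewrite prod_sum_branch; apply: eq_bigr => x _.
by rewrite leafwiseS big_split.
Qed.

(** What is seen at a vertex of the last but one level when its [d] children are
    the leaves. *)
Definition offspring (L : finType) (om : L -> 'I_q -> R) (b : {ffun 'I_d -> L}) i :=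
  \prod_(c < d) edge lam (om (b c)) i.

(** The recursion of [level_law] adds a level at the root; this is the same process
    with the level added at the bottom. *)
Lemma level_law_offspring m (L : finType) (om : L -> 'I_q -> R)
    (x : {ffun m.+1.-tuple 'I_d -> L}) :
  level_law om x = level_law (offspring om) (curry_ffun (@rcons_tuple m 'I_d) x).
Proof.
elim: m x => [|m IH] x; apply/funext => i /=.
  apply: eq_bigr => c _; rewrite /branch !ffunE; congr (edge _ (om (x _)) _).
  exact: val_inj.
apply: eq_bigr => c _; have /= -> := IH (branch x c).
congr (edge _ (level_law _ _) _); apply/ffunP => u; rewrite /branch !ffunE.
apply/ffunP => c'.
rewrite !ffunE; congr (x _); exact: val_inj.
Qed.

Lemma nonneg_level_law m (L : finType) (om : L -> 'I_q -> R)
    (x : {ffun m.-tuple 'I_d -> L}) :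
  0 <= lam <= 1 -> (forall a, nonneg (om a)) -> nonneg (level_law om x).
Proof.
move=> l01 om0; elim: m x => [|m IH] x; first exact: om0.
by move=> i; apply: prodr_ge0 => c _; exact: (nonneg_edge l01 (IH _)).
Qed.

Lemma sum_level_law m (L : finType) (om : L -> 'I_q -> R) i : (0 < q)%N ->
  (forall j, \sum_a om a j = 1) ->
  \sum_(x : {ffun m.-tuple 'I_d -> L}) level_law om x i = 1.
Proof.
move=> q0 om1; elim: m i => [|m IH] i /=.
  by rewrite (sum_ffun_tuple0 _ (fun a => om a i)).
rewrite -(prod_sum_branch (fun _ x => edge lam (level_law om x) i)) big1// => c _.
rewrite /edge big_split/= -!mulr_sumr IH /mass exchange_big/=.
rewrite (eq_bigr (fun=> 1)) => [|j _]; last exact: IH.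
by rewrite sumr_const card_ord; field; rewrite pnatr_eq0 -lt0n.
Qed.

Lemma sum_level_law_S m (L : finType) (om : L -> 'I_q -> R) psi :
  \sum_(x : {ffun m.+1.-tuple 'I_d -> L}) psi (level_law om x) =
  iter d (absorb (fun x : {ffun m.-tuple 'I_d -> L} => edge lam (level_law om x))) psi
    (fun=> 1).
Proof.
rewrite iter_absorbE -sum_branch; apply: eq_bigr => x _.
by congr psi; apply/funext => i; rewrite mul1r.
Qed.

Lemma sqrtr_prod (I : finType) (h : I -> R) :
  (forall i, 0 <= h i) -> \prod_i Num.sqrt (h i) = Num.sqrt (\prod_i h i).
Proof.
move=> h0; suff [] : \prod_i Num.sqrt (h i) = Num.sqrt (\prod_i h i) /\
   0 <= \prod_i h i by [].
elim/big_ind2: _ => [|a b a' b' [-> b0] [-> b0']|i _].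
- by rewrite sqrtr1.
- by rewrite sqrtrM ?mulr_ge0.
- by rewrite h0.
Qed.

Lemma sqrt_overlap_level_lawS m (L : finType) (om : L -> 'I_q -> R) i j :
  0 <= lam <= 1 -> (forall a, nonneg (om a)) ->
  sqrt_overlap (level_law om (m := m.+1)) i j =
  sqrt_overlap (fun x : {ffun m.-tuple 'I_d -> L} =>
    edge lam (level_law om x)) i j ^+ d.
Proof.
move=> l01 om0; rewrite (_ : forall a : R, a ^+ d = \prod_(c < d) a); last first.
  by move=> a; rewrite prodr_const card_ord.
rewrite prod_sum_branch; apply: eq_bigr => x _ /=.
rewrite sqrtr_prod ?big_split// => c.
by apply: mulr_ge0; exact/nonneg_edge/nonneg_level_law.
Qed.

Definition sqmass_loss (L L' : finType) (D : L -> L' -> R) (om : L -> 'I_q -> R) m :=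
  \sum_(x : {ffun m.-tuple 'I_d -> L}) sqmass (level_law om x)
  - \sum_(y : {ffun m.-tuple 'I_d -> L'}) sqmass (level_law (degrade D om) y).

Lemma sqmass_loss_ge0 (L L' : finType) (D : L -> L' -> R) (om : L -> 'I_q -> R) m :
  0 <= lam <= 1 -> stochastic D -> (forall a, nonneg (om a)) ->
  0 <= sqmass_loss D om m.
Proof.
move=> l01 DS om0; rewrite /sqmass_loss level_law_degrade.
have [S0 S1] := stochastic_leafwise m DS.
have lev0 (x : {ffun m.-tuple 'I_d -> L}) : nonneg (level_law om x)
  by exact: nonneg_level_law.
rewrite sqmass_gap//.
apply: sumr_ge0 => x _; apply: sumr_ge0 => y _; apply: mulr_ge0 => //.
apply: mulr_ge0; first exact: mass_ge0.
by apply: sumr_ge0 => i _; exact: sqr_ge0.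
Qed.

(** [replace_children] started from [v = 1], whose overlap is at most [q ^ 2]. *)
Lemma sqmass_loss_contract (L L' : finType) (D : L -> L' -> R)
    (om : L -> 'I_q -> R) (b : R) m :
  (0 < q)%N -> 0 <= lam < 1 -> stochastic D -> (forall a, nonneg (om a)) ->
  (forall i j, i != j ->
    sqrt_overlap (fun x : {ffun m.-tuple 'I_d -> L} =>
      edge lam (level_law om x)) i j <= b) ->
  (forall i j, i != j ->
    sqrt_overlap (fun y : {ffun m.-tuple 'I_d -> L'} =>
      edge lam (level_law (degrade D om) y)) i j <= b) ->
  0 <= b ->
  sqmass_loss D om m.+1 <=
  d%:R * (4 * lam ^+ 2 / ((1 - lam) / q%:R) ^+ 4 * b ^+ d.-1) * q%:R ^+ 2
  * sqmass_loss D om m.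
Proof.
move=> q0 l01 DS om0 fb gb b0.
have l01' : 0 <= lam <= 1 by case/andP: l01 => -> /ltW ->.
have om0' a : nonneg (degrade D om a) by exact: nonneg_degrade.
have loss0 := sqmass_loss_ge0 m l01' DS om0.
have c0 : 0 <= 4 * lam ^+ 2 / ((1 - lam) / q%:R) ^+ 4.
  apply: divr_ge0; first exact: mulr_ge0 _ (sqr_ge0 _).
  by rewrite exprn_even_ge0.
rewrite {1}/sqmass_loss !sum_level_law_S.
apply: (le_trans (replace_children (b := b)
  (c := 4 * lam ^+ 2 / ((1 - lam) / q%:R) ^+ 4 * sqmass_loss D om m)
  d _ _ _ _ fb gb _ _)) => //.
- by move=> x; exact/nonneg_edge/nonneg_level_law.
- by move=> x; exact/nonneg_edge/nonneg_level_law.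
- exact: mulr_ge0.
- move=> u u0; rewrite /sqmass_loss level_law_degrade; apply: replace_one_child => //.
    exact: stochastic_leafwise.
  by move=> x; exact: nonneg_level_law.
set e := overlap _; have e1 : e <= q%:R ^+ 2.
  apply: (@le_trans _ _ (\sum_(i < q) \sum_(j < q) 1)).
    apply: ler_sum => i _; rewrite [leRHS](bigID (fun j => j != i))/=.
    rewrite -[leLHS]addr0; apply: lerD; last exact: sumr_ge0.
    by apply: ler_sum => j _; rewrite mulr1 sqrtr1.
  by rewrite !sumr_const card_ord expr2 mulr_natr.
have -> : d%:R * (4 * lam ^+ 2 / ((1 - lam) / q%:R) ^+ 4 * sqmass_loss D om m
     * b ^+ d.-1) * e =
   (d%:R * (4 * lam ^+ 2 / ((1 - lam) / q%:R) ^+ 4 * b ^+ d.-1)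
     * sqmass_loss D om m) * e by ring.
rewrite [leRHS]mulrAC ler_wpM2l//.
apply: mulr_ge0 => //; apply: mulr_ge0 => //; apply: mulr_ge0 => //.
exact: exprn_ge0.
Qed.

End Tree.

(** * Bhattacharyya coefficients *)

Section Distances.
Context {R : realType} {q : nat} {F : finType}.
Implicit Types (f : F -> 'I_q -> R) (lam : R).

Definition l1_distance f i j := \sum_x `|f x i - f x j|.

Lemma sqrt_overlap_ge0 f i j : 0 <= sqrt_overlap f i j.
Proof. by apply: sumr_ge0 => x _; exact: sqrtr_ge0. Qed.

(** With [x], [y] the square roots, the right side minus the left side is
    [(x - y - t (x + y) / 2) ^ 2 / 2 + t ^ 2 (x - y) ^ 2 / 8] if [x >= y]. The free
    parameter [t] replaces an application of Cauchy-Schwarz after summation. *)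
Lemma sqrtM_le (a b t : R) : 0 <= a -> 0 <= b -> 0 <= t ->
  Num.sqrt (a * b) <= (a + b) / 2 - t * `|a - b| / 2 + t ^+ 2 * (a + b) / 4.
Proof.
move=> a0 b0 t0; rewrite sqrtrM//.
have {2 3 4}-> : a = Num.sqrt a ^+ 2 by rewrite sqr_sqrtr.
have {2 3 4}-> : b = Num.sqrt b ^+ 2 by rewrite sqr_sqrtr.
have := sqrtr_ge0 a; have := sqrtr_ge0 b.
set x := Num.sqrt a; set y := Num.sqrt b => y0 x0.
have [xy|/ltW xy] := lerP y x.
  have z0 : 0 <= x ^+ 2 - y ^+ 2 by rewrite subr_ge0 lerXn2r.
  rewrite ger0_norm//.
  have := sqr_ge0 (x - y - t * (x + y) / 2); have := sqr_ge0 (t * (x - y)).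
  nra.
have z0 : x ^+ 2 - y ^+ 2 <= 0 by rewrite subr_le0 lerXn2r.
rewrite ler0_norm//.
have := sqr_ge0 (y - x - t * (x + y) / 2); have := sqr_ge0 (t * (x - y)).
nra.
Qed.

(** The left side is the minimum of [a] and [b]. *)
Lemma sqrtM_ge (a b : R) : 0 <= a -> 0 <= b ->
  (a + b) / 2 - `|a - b| / 2 <= Num.sqrt (a * b).
Proof.
move=> a0 b0; have [ab|/ltW ab] := lerP b a.
  rewrite (_ : _ - _ = b); last by field.
  by rewrite -[leLHS]ger0_norm// -sqrtr_sqr ler_wsqrtr// expr2 ler_wpM2r.
rewrite (_ : _ - _ = a); last by field.
by rewrite -[leLHS]ger0_norm// -sqrtr_sqr ler_wsqrtr// expr2 ler_wpM2l.
Qed.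

Lemma l1_distance_ge f i j : (forall x, nonneg (f x)) ->
  (forall i, \sum_x f x i = 1) ->
  2 - 2 * sqrt_overlap f i j <= l1_distance f i j.
Proof.
move=> f0 f1.
have : \sum_x ((f x i + f x j) / 2 - `|f x i - f x j| / 2) <= sqrt_overlap f i j.
  by apply: ler_sum => x _; exact: sqrtM_ge (f0 x i) (f0 x j).
rewrite sumrB -!mulr_suml big_split/= !f1 -/(l1_distance f i j); lra.
Qed.

Lemma sum_edge f lam i : (0 < q)%N -> (forall i, \sum_x f x i = 1) ->
  \sum_x edge lam (f x) i = 1.
Proof.
move=> q0 f1; rewrite /edge big_split/= -!mulr_sumr f1 /mass exchange_big/=.
rewrite (eq_bigr (fun=> 1)) => [|j _]; last exact: f1.
by rewrite sumr_const card_ord; field; rewrite pnatr_eq0 -lt0n.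
Qed.

(** The edge multiplies the l1 distance by [lam], and [sqrtM_le] with [t = lam / 3]
    turns the distance [2 / 3] into a coefficient
    [1 - lam ^ 2 / 9 + lam ^ 2 / 18]. *)
Lemma sqrt_overlap_edge f lam i j : (0 < q)%N -> 0 <= lam <= 1 ->
  (forall x, nonneg (f x)) -> (forall i, \sum_x f x i = 1) ->
  2 / 3 <= l1_distance f i j ->
  sqrt_overlap (fun x => edge lam (f x)) i j <= 1 - lam ^+ 2 / 18.
Proof.
move=> q0 l01 f0 f1 fd; have /andP[l0 _] := l01.
have : sqrt_overlap (fun x => edge lam (f x)) i j <=
  \sum_x ((edge lam (f x) i + edge lam (f x) j) / 2
    - (lam / 3) * `|edge lam (f x) i - edge lam (f x) j| / 2
    + (lam / 3) ^+ 2 * (edge lam (f x) i + edge lam (f x) j) / 4).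
  apply: ler_sum => x _; apply: sqrtM_le; last by rewrite divr_ge0.
    exact: nonneg_edge.
  exact: nonneg_edge.
rewrite big_split/= sumrB/= -!mulr_suml -!mulr_sumr big_split/= !sum_edge//.
have -> : \sum_x `|edge lam (f x) i - edge lam (f x) j| = lam * l1_distance f i j.
  rewrite mulr_sumr; apply: eq_bigr => x _.
  by rewrite -{3}(ger0_norm l0) -normrM; congr `| _ |; rewrite /edge; ring.
have : lam ^+ 2 * (2 / 3) <= lam ^+ 2 * l1_distance f i j.
  by rewrite ler_wpM2l// sqr_ge0.
nra.
Qed.

(** With probability [1 - lam] the child is resampled; by subadditivity of the
    square root this changes the coefficient by [O (sqrt (1 - lam))]. *)
Lemma sqrt_overlap_edge_near1 f lam i j : (0 < q)%N -> 0 <= lam <= 1 ->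
  (forall x, nonneg (f x)) -> (forall i, \sum_x f x i = 1) ->
  sqrt_overlap (fun x => edge lam (f x)) i j <=
  sqrt_overlap f i j + 3 * Num.sqrt (1 - lam).
Proof.
move=> q0 /andP[l0 l1] f0 f1; set s := Num.sqrt (1 - lam).
have s0 : 0 <= s by exact: sqrtr_ge0.
have s2 : s ^+ 2 = 1 - lam by rewrite sqr_sqrtr// subr_ge0.
have s1 : s <= 1 by rewrite -sqrtr1 ler_wsqrtr// gerBl.
(* The law of the observation for a uniform label. *)
pose n x := mass (f x) / q%:R.
have n0 x : 0 <= n x by rewrite divr_ge0// mass_ge0.
have sn : \sum_x n x = 1.
  rewrite -mulr_suml /mass exchange_big/= (eq_bigr (fun=> 1)) => [|k _]; last exact: f1.
  by rewrite sumr_const card_ord mulfV// pnatr_eq0 -lt0n.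
apply: (@le_trans _ _ (\sum_x (Num.sqrt (f x i * f x j)
    + s * (n x + f x i + f x j) / 2 + s ^+ 2 * n x))).
  apply: ler_sum => x _; rewrite /edge.
  have kE : (1 - lam) / q%:R * mass (f x) = s ^+ 2 * n x.
    by rewrite s2 /n mulrA mulrAC.
  rewrite kE; have := n0 x; have := f0 x i; have := f0 x j.
  move: (n x) (f x i) (f x j) => c a b b0 a0 c0 {kE}.
  set r := Num.sqrt (a * b).
  have r0 : 0 <= r by exact: sqrtr_ge0.
  have r2 : r ^+ 2 = a * b by rewrite sqr_sqrtr// mulr_ge0.
  have w0 : 0 <= s * (c + a + b) / 2 by rewrite divr_ge0// mulr_ge0// !addr_ge0.
  have v0 : 0 <= s ^+ 2 * c by rewrite mulr_ge0// sqr_ge0.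
  have y0 : 0 <= r + s * (c + a + b) / 2 + s ^+ 2 * c by rewrite !addr_ge0.
  rewrite -[leRHS]ger0_norm// -sqrtr_sqr ler_wsqrtr//.
  apply: (@le_trans _ _ (r ^+ 2 + (s * (c + a + b) / 2) ^+ 2 + (s ^+ 2 * c) ^+ 2)).
    have lab : lam ^+ 2 * (a * b) <= 1 * (a * b).
      by rewrite ler_wpM2r ?mulr_ge0// expr_le1.
    have lcb : lam * (s ^+ 2 * (c * (a + b))) <= 1 * (s ^+ 2 * (c * (a + b))).
      by rewrite ler_wpM2r// !mulr_ge0 ?sqr_ge0 ?addr_ge0.
    have : 0 <= s ^+ 2 * (c - (a + b)) ^+ 2 by rewrite mulr_ge0 ?sqr_ge0.
    rewrite r2; nra.
  have := mulr_ge0 r0 w0; have := mulr_ge0 r0 v0; have := mulr_ge0 w0 v0.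
  move: (s * _ / 2) (s ^+ 2 * c) => u1 u2; nra.
rewrite !big_split/= -mulr_suml -!mulr_sumr !big_split/= sn !f1.
rewrite -/(sqrt_overlap f i j) s2.
have : s ^+ 2 <= s by rewrite expr2 -[leRHS]mul1r ler_wpM2r.
rewrite s2; lra.
Qed.

End Distances.

(** * Coefficients of the levels of the tree *)

Section LevelOverlap.
Context {R : realType} {q d : nat} (lam : R) {L : finType} (om : L -> 'I_q -> R).
Context (q0 : (0 < q)%N) (l01 : 0 <= lam <= 1).
Context (om0 : forall a, nonneg (om a)) (om1 : forall i, \sum_a om a i = 1).
Context (om_dist : forall i j, i != j -> 2 / 3 <= l1_distance om i j).
Context (pow_small : (1 - lam ^+ 2 / 18) ^+ d <= 8^-1).

Let levd m : {ffun m.-tuple 'I_d -> L} -> 'I_q -> R := level_law lam om (m := m).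

Let lev0 m x : nonneg (@levd m x). Proof. exact: nonneg_level_law. Qed.
Let lev1 m i : \sum_x @levd m x i = 1. Proof. exact: sum_level_law. Qed.

(** The bound [2 / 3 <= l1_distance] passes from one level to the next: it makes the
    coefficient of one child at most [1 - lam ^ 2 / 18], the coefficient of [d] children
    at most [1 / 8], and this gives an l1 distance of at least [7 / 4]. *)
Lemma child_overlap_le m i j : i != j ->
  sqrt_overlap (fun x => edge lam (levd (m := m) x)) i j <= 1 - lam ^+ 2 / 18.
Proof.
move=> ij; apply: sqrt_overlap_edge => //.
elim: m => [|m IH].
  rewrite /l1_distance /levd/=.
  by rewrite (sum_ffun_tuple0 _ (fun a => `|om a i - om a j|)) om_dist.
apply: le_trans (l1_distance_ge _ _ _ _) => //.
rewrite sqrt_overlap_level_lawS// -/(levd _).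
have : sqrt_overlap (fun x => edge lam (levd (m := m) x)) i j ^+ d
    <= (1 - lam ^+ 2 / 18) ^+ d.
  apply: lerXn2r; rewrite ?nnegrE ?sqrt_overlap_ge0//.
    by case/andP: l01 => l0 l1; nra.
  exact: sqrt_overlap_edge.
by have := pow_small; lra.
Qed.

Lemma level_overlap_le m i j : i != j ->
  sqrt_overlap (levd (m := m.+1)) i j <= 8^-1.
Proof.
move=> ij; rewrite sqrt_overlap_level_lawS//; apply: le_trans pow_small.
apply: lerXn2r; rewrite ?nnegrE ?sqrt_overlap_ge0 ?child_overlap_le//.
by case/andP: l01 => l0 l1; nra.
Qed.

(** With [s = sqrt (1 - lam)] and coefficient [k] at some level, the next one is at
    most [(k + 3 s) ^ d <= (k + 3 s) / 4], since [k + 3 s <= 1 / 4]; the fixed point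
    of this affine bound is [s]. *)
Lemma level_overlap_near1 m i j : (2 <= d)%N -> 3 * Num.sqrt (1 - lam) <= 8^-1 ->
  i != j ->
  sqrt_overlap (levd (m := m.+1)) i j <= 4^-1 ^+ m / 8 + Num.sqrt (1 - lam).
Proof.
move=> d2 s8 ij; set s := Num.sqrt _ in s8 *.
have s0 : 0 <= s by exact: sqrtr_ge0.
elim: m => [|m IH].
  by rewrite expr0 mul1r (le_trans (level_overlap_le 0 ij))// lerDl.
rewrite sqrt_overlap_level_lawS// -/(levd _).
have := sqrt_overlap_edge_near1 i j q0 l01 (@lev0 m.+1) (@lev1 m.+1).
rewrite -/s; have := sqrt_overlap_ge0 (fun x => edge lam (levd (m := m.+1) x)) i j.
have := level_overlap_le m ij; move: IH.
set b := sqrt_overlap (levd (m := m.+1)) i j; set k := sqrt_overlap _ i j.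
move=> IH b8 k0 kb; have k4 : k <= 4^-1 by lra.
apply: (@le_trans _ _ (k * 4^-1)).
  apply: (@le_trans _ _ (k ^+ 2)); last by rewrite expr2 ler_wpM2l.
  apply: ler_wiXn2l => //; lra.
rewrite exprS; lra.
Qed.

End LevelOverlap.

(** * Numerical bounds on the contraction ratio *)

Section Constants.
Context {R : realType}.
Implicit Types (lam x s Q : R).

Lemma expr_1sub_le x n : 0 <= x <= 1 -> (1 - x) ^+ n <= (1 + n%:R * x)^-1.
Proof.
move=> /andP[x0 x1]; have p m : 0 < 1 + m%:R * x by rewrite ltr_pwDl// mulr_ge0.
rewrite -[leRHS]mul1r ler_pdivlMr//; elim: n => [|n IH].
  by rewrite expr0 mul0r addr0 mulr1.
apply: le_trans IH; rewrite exprS mulrAC mulrC ler_wpM2l//.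
  by rewrite exprn_ge0// subr_ge0.
rewrite -natr1.
have : 0 <= n%:R * x ^+ 2 by rewrite mulr_ge0// sqr_ge0.
nra.
Qed.

Lemma pow_small lam d : 0 <= lam <= 1 -> 126 <= lam ^+ 2 * d%:R ->
  (1 - lam ^+ 2 / 18) ^+ d <= 8^-1.
Proof.
move=> /andP[l0 l1] y.
have l2 : lam ^+ 2 <= 1 by rewrite expr_le1.
have l20 := sqr_ge0 lam.
apply: le_trans (expr_1sub_le _ _) _; first by apply/andP; split; lra.
rewrite lef_pV2 ?posrE//; lra.
Qed.

(** With [Q] the number of labels, [4 * Q ^ 6 * 24 ^ 8]; the contraction is
    studied separately for [1 - lam] above and below [1 / 576 = 24 ^- 2]. *)
Definition rate Q : R := 4 * Q ^+ 6 * 576 ^+ 4.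

Definition threshold Q : R := 2 * 72 ^+ 2 * rate Q.

Lemma rate_ge Q : 1 <= Q -> 1 <= rate Q.
Proof.
move=> Q1; rewrite /rate -mulrA mulr_ege1// ?ler1n// mulr_ege1// exprn_ege1//.
by rewrite ler1n.
Qed.

(** With [y = lam ^ 2 * d], the power [(1 - lam ^ 2 / 18) ^ (d - 1)] is at most
    [(72 / y) ^ 2], while the factor in front is of order [y]. *)
Lemma ratio_far lam Q d : 1 <= Q -> (4 <= d)%N -> 0 < lam < 1 ->
  1 <= 576 * (1 - lam) -> threshold Q <= lam ^+ 2 * d%:R ->
  d%:R * (4 * lam ^+ 2 / ((1 - lam) / Q) ^+ 4 * (1 - lam ^+ 2 / 18) ^+ d.-1) * Q ^+ 2
  <= 2^-1.
Proof.
move=> Q1 d4 /andP[l0 l1] lfar yC; have Q0 : 0 < Q by lra.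
set x := lam ^+ 2 / 18; set y := lam ^+ 2 * d%:R in yC *.
have l2 : lam ^+ 2 <= 1 by rewrite expr_le1// ltW.
have l20 : 0 < lam ^+ 2 by exact: exprn_gt0.
have x01 : 0 <= x <= 1 by rewrite /x; apply/andP; split; lra.
have y0 : 0 < y by rewrite mulr_gt0// ltr0n (leq_trans _ d4).
have pow : (1 - x) ^+ d.-1 <= 72 ^+ 2 / y ^+ 2.
  (* Bernoulli's inequality is used twice, each time with half of the exponent. *)
  set k := d.-1./2.
  have dk : (d <= 4 * k)%N.
    rewrite /k; case: d d4 {yC y y0 k} => // d d4 /=.
    have := odd_double_half d; rewrite -mul2n.
    have : (odd d <= 1)%N by case: (odd d).
    have : (1 <= d./2)%N by rewrite half_gt0; exact: ltnW d4.
    move: (odd d : nat) d./2 => a b; lia.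
  have k2 : (k * 2 <= d.-1)%N by rewrite muln2 -[leqRHS]odd_double_half leq_addl.
  apply: (@le_trans _ _ (((1 - x) ^+ k) ^+ 2)).
    case/andP: x01 => x0 x1; rewrite -exprM; apply: ler_wiXn2l => //; lra.
  rewrite -expr_div_n lerXn2r ?nnegrE//.
  - by apply: exprn_ge0; case/andP: x01 => _; rewrite subr_ge0.
  - by rewrite divr_ge0// ltW.
  apply: le_trans (expr_1sub_le _ x01) _.
  rewrite -invf_div lef_pV2 ?posrE ?divr_gt0//; last first.
    by rewrite ltr_pwDl// mulr_ge0//; case/andP: x01.
  have : d%:R <= 4 * k%:R :> R by rewrite -natrM ler_nat.
  rewrite /y /x => dk'.
  have := ler_wpM2l (ltW l20) dk'; lra.
have inv4 : (((1 - lam) / Q) ^+ 4)^-1 <= Q ^+ 4 * 576 ^+ 4.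
  have k0 : 0 <= Q / (1 - lam) by rewrite divr_ge0 ?subr_ge0 ?(ltW Q0) ?(ltW l1).
  have k1 : Q / (1 - lam) <= Q * 576.
    by rewrite ler_pdivrMr ?subr_gt0// -mulrA ler_peMr ?(ltW Q0).
  rewrite -exprVn invf_div -(exprMn 4 Q 576).
  exact: (lerXn2r 4 k0 (le_trans k0 k1) k1).
have r0 := rate_ge Q1.
have key : d%:R * (4 * lam ^+ 2 / ((1 - lam) / Q) ^+ 4 * (1 - x) ^+ d.-1) * Q ^+ 2
    <= rate Q * (72 ^+ 2 / y).
  have -> : rate Q * (72 ^+ 2 / y) =
     d%:R * (4 * lam ^+ 2 * (Q ^+ 4 * 576 ^+ 4) * (72 ^+ 2 / y ^+ 2)) * Q ^+ 2.
    have -> : 72 ^+ 2 / y = y * (72 ^+ 2 / y ^+ 2) by field; rewrite gt_eqF.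
    rewrite /rate {1}/y; move: (72 ^+ 2 / y ^+ 2) (576 ^+ 4) => A B; ring.
  rewrite ler_wpM2r ?sqr_ge0// ler_wpM2l// ler_pM//.
  - apply: divr_ge0; first exact: mulr_ge0 _ (sqr_ge0 _).
    by rewrite exprn_even_ge0.
  - by apply: exprn_ge0; case/andP: x01 => _; rewrite subr_ge0.
  - by rewrite ler_wpM2l// mulr_ge0// sqr_ge0.
apply: (le_trans key); rewrite mulrA ler_pdivrMr//.
rewrite ler_pdivlMl//; apply: le_trans yC.
by rewrite /threshold le_eqVlt; apply/orP; left; apply/eqP; ring.
Qed.

(** Eight of the [d - 1] factors [6 s] cancel [(1 - lam) ^- 4 = s ^- 8], and the others,
    at most [1 / 4] each, beat the factor [d]. *)
Lemma ratio_near lam Q s d : 1 <= Q -> (9 <= d)%N -> 0 <= lam < 1 ->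
  1 - lam = s ^+ 2 -> 0 < s -> 24 * s <= 1 -> 8 * rate Q <= d%:R ->
  d%:R * (4 * lam ^+ 2 / ((1 - lam) / Q) ^+ 4 * (6 * s) ^+ d.-1) * Q ^+ 2 <= 2^-1.
Proof.
move=> Q1 d9 /andP[l0 l1] -> s0 s24 dC; have Q0 : 0 < Q by lra.
have l2 : lam ^+ 2 <= 1 by rewrite expr_le1// ltW.
have d0 : 0 < d%:R :> R by rewrite ltr0n (leq_trans _ d9).
have r0 := rate_ge Q1.
have de : d.-1 = ((d - 9) + 8)%N by lia.
have pow : (6 * s) ^+ d.-1 <= 4^-1 ^+ (d - 9) * (6 * s) ^+ 8.
  rewrite de exprD ler_wpM2r ?exprn_ge0 ?mulr_ge0 ?(ltW s0)//.
  by rewrite lerXn2r ?nnegrE ?mulr_ge0 ?(ltW s0)//; lra.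
have pow4 : 4^-1 ^+ (d - 9) <= 4 ^+ 9 / d%:R ^+ 2 :> R.
  rewrite exprVn -invf_div lef_pV2 ?posrE ?divr_gt0 ?exprn_gt0//.
  rewrite ler_pdivrMr ?exprn_gt0// -exprD subnK//.
  rewrite -[4 in leRHS](_ : 2 ^+ 2 = _); last by rewrite -natrX.
  rewrite -exprM mulnC exprM lerXn2r ?nnegrE ?exprn_ge0//.
  by rewrite -natrX ler_nat ltnW// ltn_expl.
apply: (@le_trans _ _ (d%:R * (4 * 1 / (s ^+ 2 / Q) ^+ 4 *
    ((4 ^+ 9 / d%:R ^+ 2) * (6 * s) ^+ 8)) * Q ^+ 2)).
  have p40 : 0 <= ((s ^+ 2 / Q) ^+ 4)^-1 by rewrite invr_ge0 exprn_even_ge0.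
  rewrite ler_wpM2r ?sqr_ge0// ler_wpM2l ?(ltW d0)// ler_pM//.
  - by rewrite mulr_ge0// mulr_ge0// sqr_ge0.
  - by rewrite exprn_ge0// mulr_ge0// ltW.
  - by rewrite ler_wpM2r// ler_wpM2l.
  - by apply: (le_trans pow); rewrite ler_wpM2r// exprn_ge0// mulr_ge0// ltW.
have -> : d%:R * (4 * 1 / (s ^+ 2 / Q) ^+ 4 *
    ((4 ^+ 9 / d%:R ^+ 2) * (6 * s) ^+ 8)) * Q ^+ 2 = 4 * rate Q / d%:R.
  rewrite /rate; field; rewrite !gt_eqF//.
by rewrite ler_pdivrMr//; lra.
Qed.

End Constants.

(** * The loss tends to zero *)

Section LossVanishes.
Context {R : realType}.

Lemma cvg0_contract (u : nat -> R) m0 :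
  (forall m, 0 <= u m) -> (forall m, (m0 <= m)%N -> u m.+1 <= 2^-1 * u m) ->
  u @ \oo --> 0.
Proof.
move=> u0 uc; rewrite -(cvg_shiftn m0).
apply: (@squeeze_cvgr _ _ _ _ (fun=> 0) (fun k => u m0 * 2^-1 ^+ k)).
- near=> k; rewrite /= u0/=; elim: (k : nat) => [|n IH].
    by rewrite expr0 mulr1.
  rewrite addSn (le_trans (uc _ (leq_addl _ _)))// exprS mulrCA ler_wpM2l//.
- exact: cvg_cst.
- rewrite -[X in _ --> X](mulr0 (u m0)); apply: cvgM; first exact: cvg_cst.
  by apply: cvg_expr; rewrite ger0_norm// invf_lt1// ltr1n.
Unshelve. all: by end_near. Qed.

Context {q d : nat} {lam : R} {L L' : finType} (D : L -> L' -> R) (om : L -> 'I_q -> R).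

(** Three cases: for [lam = 1] the loss is at most [q ^ 2] times the largest
    coefficient, which decays geometrically; for smaller [lam] the loss is eventually
    halved at each level, by [ratio_far] or by [ratio_near]. *)
Lemma sqmass_loss_cvg0 : (0 < q)%N -> 0 <= lam <= 1 ->
  threshold q%:R < lam ^+ 2 * d%:R ->
  stochastic D -> (forall a, nonneg (om a)) -> (forall i, \sum_a om a i = 1) ->
  (forall i j, i != j -> 2 / 3 <= l1_distance om i j) ->
  (forall i j, i != j -> 2 / 3 <= l1_distance (degrade D om) i j) ->
  sqmass_loss d lam D om m @[m --> \oo] --> 0.
Proof.
move=> q0 l01 yC DS om0 om1 omd omd'; have /andP[l0 l1] := l01.
have Q1 : 1 <= q%:R :> R by rewrite ler1n.
have rateQ := rate_ge Q1.
have l2 : lam ^+ 2 <= 1 by rewrite expr_le1.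
have yC' : 10000 * rate q%:R <= lam ^+ 2 * d%:R.
  by apply: le_trans (ltW yC); rewrite /threshold ler_wpM2r//; lra.
have dy : lam ^+ 2 * d%:R <= d%:R by rewrite ler_piMl.
have d9 : (9 <= d)%N by rewrite -(ler_nat R); lra.
have pw : (1 - lam ^+ 2 / 18) ^+ d <= 8^-1 by apply: pow_small => //; lra.
have om0' a : nonneg (degrade D om a) by exact: nonneg_degrade.
have om1' i : \sum_b degrade D om b i = 1.
  rewrite exchange_big -[RHS](om1 i); apply: eq_bigr => a _.
  by rewrite -mulr_suml DS.2 mul1r.
have loss0 m : 0 <= sqmass_loss d lam D om m by exact: sqmass_loss_ge0.
have [l1'|] := ltrP lam 1; last first.
  move=> l1'; have l1E : lam = 1 by lra.
  have s0 : Num.sqrt (1 - lam) = 0 by rewrite l1E subrr sqrtr0.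
  have lossE m : sqmass_loss d lam D om m.+1 <= q%:R ^+ 2 * 4^-1 ^+ m.
    rewrite /sqmass_loss.
    apply: (@le_trans _ _ (\sum_(y : {ffun m.+1.-tuple 'I_d -> L'})
        overlap (level_law lam (degrade D om) y))).
      apply: (@le_trans _ _ (\sum_(y : {ffun m.+1.-tuple 'I_d -> L'})
          (mass (level_law lam (degrade D om) y)
           - sqmass (level_law lam (degrade D om) y)))).
        rewrite sumrB lerB//.
        have -> : \sum_(y : {ffun m.+1.-tuple 'I_d -> L'})
            mass (level_law lam (degrade D om) y) =
            \sum_(x : {ffun m.+1.-tuple 'I_d -> L}) mass (level_law lam om x).
          rewrite /mass [LHS]exchange_big [RHS]exchange_big/=.
          by apply: eq_bigr => i _; rewrite !sum_level_law.
        apply: ler_sum => x _; rewrite sqmassE; apply: ler_sum => i _.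
        have lev0 : nonneg (level_law lam om x) by exact: nonneg_level_law.
        by rewrite -[leRHS]mulr1 ler_wpM2l// normalize_le1.
      by apply: ler_sum => y _; apply: mass_sub_sqmass; exact: nonneg_level_law.
    rewrite /overlap exchange_big/=.
    apply: (@le_trans _ _ (\sum_(i < q) \sum_(j < q) 4^-1 ^+ m)); last first.
      by rewrite !sumr_const card_ord -[leLHS]mulr_natl -[X in _ * X]mulr_natl
        mulrA expr2.
    apply: ler_sum => i _; rewrite exchange_big/= big_mkcond/=.
    apply: ler_sum => j _; case: ifP => // ji.
    apply: le_trans (level_overlap_near1 q0 l01 om0' om1' omd' pw m _ _ _) _.
    - exact: leq_trans d9.
    - by rewrite s0 mulr0 invr_ge0.
    - by rewrite eq_sym.
    rewrite s0 addr0 ler_piMr// ?invf_le1// ?exprn_ge0// ?ler1n//.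
  rewrite -(cvg_shiftn 1).
  apply: (@squeeze_cvgr _ _ _ _ (fun=> 0) (fun k => q%:R ^+ 2 * 4^-1 ^+ k)).
  - by near=> k; rewrite /= addn1 loss0 lossE.
  - exact: cvg_cst.
  - rewrite -[X in _ --> X](mulr0 (q%:R ^+ 2)); apply: cvgM; first exact: cvg_cst.
    by apply: cvg_expr; rewrite ger0_norm// invf_lt1// ltr1n.
have l01' : 0 <= lam < 1 by rewrite l0.
have lp : 0 < lam.
  rewrite lt_def l0 andbT; apply/eqP => lz.
  by move: yC'; rewrite lz expr0n/= mul0r; lra.
have [lfar|lnear] := lerP 1 (576 * (1 - lam)).
  apply: (@cvg0_contract _ 0) => // m _.
  apply: le_trans (sqmass_loss_contract q0 l01' DS om0
    (child_overlap_le q0 l01 om0 om1 omd pw m)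
    (child_overlap_le q0 l01 om0' om1' omd' pw m) _) _.
    by lra.
  rewrite ler_wpM2r// ratio_far//; last exact: ltW.
  - exact: leq_trans d9.
  - by rewrite lp.
set s := Num.sqrt (1 - lam).
have s2 : 1 - lam = s ^+ 2 by rewrite sqr_sqrtr// subr_ge0.
have s0 : 0 < s by rewrite sqrtr_gt0 subr_gt0.
have s24 : 24 * s <= 1 by rewrite leNgt; apply/negP => H; nra.
(* From level [m0 + 1] on, every coefficient is at most [3 s], so that of a child is
   at most [6 s]. *)
have [m0 hm0] : exists m0, forall m, (m0 <= m)%N -> 4^-1 ^+ m / 8 <= 2 * s.
  have : (4^-1 : R) ^+ m @[m --> \oo] --> 0.
    by apply: cvg_expr; rewrite ger0_norm// invf_lt1// ltr1n.
  move=> /cvgrPdist_le /(_ s s0)[m0 _ H]; exists m0 => m mm0.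
  have := H m mm0; rewrite /= sub0r normrN ger0_norm ?exprn_ge0//; lra.
apply: (@cvg0_contract _ m0.+1) => // -[//|m] mm0.
have kb (L0 : finType) (om' : L0 -> 'I_q -> R) :
    (forall a, nonneg (om' a)) -> (forall i, \sum_a om' a i = 1) ->
    (forall i j, i != j -> 2 / 3 <= l1_distance om' i j) ->
    forall i j, i != j -> sqrt_overlap (fun x : {ffun m.+1.-tuple 'I_d -> L0} =>
      edge lam (level_law lam om' x)) i j <= 6 * s.
  move=> o0 o1 od i j ij.
  apply: le_trans (sqrt_overlap_edge_near1 _ _ q0 l01 _ _) _.
  - by move=> x; exact: nonneg_level_law.
  - by move=> k; exact: sum_level_law.
  have d2 : (2 <= d)%N by exact: leq_trans d9.
  have s8 : 3 * Num.sqrt (1 - lam) <= 8^-1 by rewrite -/s; lra.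
  have := level_overlap_near1 q0 l01 o0 o1 od pw m d2 s8 ij.
  have := hm0 m mm0; rewrite -/s; lra.
apply: le_trans (sqmass_loss_contract (b := 6 * s) q0 l01' DS om0 _ _ _) _.
- exact: kb.
- exact: kb.
- by rewrite mulr_ge0// ltW.
rewrite ler_wpM2r//; apply: (ratio_near (s := s)) => //; lra.
Unshelve. all: by end_near. Qed.

End LossVanishes.

(** * Success probability of the optimal guess *)

Section MaxMass.
Context {R : realType} {q : nat}.
Implicit Types (v : 'I_q -> R).

Definition maxmass v : R := \big[Num.max/0]_i v i.

Lemma maxmass_ge0 v : 0 <= maxmass v.
Proof. exact: bigmax_ge_id. Qed.

Lemma le_maxmass v i : v i <= maxmass v.
Proof. exact: le_bigmax. Qed.

Lemma maxmass_le v c : 0 <= c -> (forall i, v i <= c) -> maxmass v <= c.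
Proof. by move=> c0 vc; apply: bigmax_le. Qed.

Lemma maxmass_normalize v : nonneg v -> mass v * maxmass (normalize v) = maxmass v.
Proof.
move=> v0; apply/le_anti/andP; split; last first.
  apply: maxmass_le; first by rewrite mulr_ge0 ?mass_ge0 ?maxmass_ge0.
  by move=> i; rewrite -{1}(mass_normalize i v0) ler_wpM2l ?mass_ge0 ?le_maxmass.
have [m0|m0] := eqVneq (mass v) 0; first by rewrite m0 mul0r maxmass_ge0.
have mp : 0 < mass v by rewrite lt_def m0 mass_ge0.
rewrite mulrC -ler_pdivlMr//; apply: maxmass_le.
  by rewrite divr_ge0 ?maxmass_ge0// ltW.
by move=> i; rewrite /normalize ler_wpM2r ?le_maxmass// invr_ge0 ltW.
Qed.

Lemma maxmass_scale c v : 0 <= c -> maxmass (fun i => c * v i) = c * maxmass v.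
Proof.
rewrite le_eqVlt => /predU1P[<-|c0].
  rewrite mul0r; apply/le_anti; rewrite maxmass_ge0 andbT.
  by apply: maxmass_le => // i; rewrite mul0r.
apply/le_anti/andP; split.
  apply: maxmass_le => [|i]; first by rewrite mulr_ge0 ?maxmass_ge0// ltW.
  by rewrite ler_pM2l ?le_maxmass.
rewrite mulrC -ler_pdivlMr//; apply: maxmass_le => [|i].
  by rewrite divr_ge0 ?maxmass_ge0// ltW.
by rewrite ler_pdivlMr// mulrC; exact: (le_maxmass (fun i => c * v i)).
Qed.

(** Data processing: the maximum of an average is at most the average of the
    maxima. *)
Lemma maxmass_degrade (F G : finType) (D : F -> G -> R) f :
  stochastic D -> (forall x, nonneg (f x)) ->
  \sum_y maxmass (degrade D f y) <= \sum_x maxmass (f x).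
Proof.
move=> DS f0; rewrite -(sum_degrade (fun x => maxmass (f x)) DS) exchange_big/=.
apply: ler_sum => y _; apply: maxmass_le.
  by apply: sumr_ge0 => x _; rewrite mulr_ge0 ?maxmass_ge0//; exact: DS.1.
move=> i; apply: ler_sum => x _; rewrite ler_wpM2l ?le_maxmass//; exact: DS.1.
Qed.

(** The maximum of a vector changes by at most the largest change [z] of an entry,
    and [z <= eps + z ^ 2 / eps]; the mean of the squares is given by
    [sqmass_gap]. *)
Lemma maxmass_gap (F G : finType) (D : F -> G -> R) f eps :
  stochastic D -> (forall x, nonneg (f x)) -> 0 < eps ->
  \sum_x maxmass (f x) - \sum_y maxmass (degrade D f y) <=
  eps * \sum_x mass (f x) +
  (\sum_x sqmass (f x) - \sum_y sqmass (degrade D f y)) / eps.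
Proof.
move=> DS f0 e0; rewrite sqmass_gap//; have [D0 D1] := DS.
set g := degrade D f.
have g0 y : nonneg (g y) by exact: nonneg_degrade.
rewrite lerBlDr -(sum_degrade (fun x => maxmass (f x)) DS).
apply: (@le_trans _ _ (\sum_x \sum_y (eps * (D x y * mass (f x)) +
   D x y * (mass (f x) * \sum_i (normalize (f x) i - normalize (g y) i) ^+ 2) / eps
   + D x y * mass (f x) * maxmass (normalize (g y))))).
  apply: ler_sum => x _; apply: ler_sum => y _.
  set H := \sum_i _.
  rewrite (_ : _ + _ = D x y * (mass (f x) *
    (eps + H / eps + maxmass (normalize (g y))))); last by ring.
  have H0 : 0 <= H by apply: sumr_ge0 => i _; exact: sqr_ge0.
  rewrite ler_wpM2l//; apply: maxmass_le.
    by rewrite mulr_ge0 ?mass_ge0// !addr_ge0 ?maxmass_ge0 ?divr_ge0// ltW.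
  move=> i; rewrite -(mass_normalize i (f0 x)) ler_wpM2l ?mass_ge0//.
  apply: (@le_trans _ _ (eps + H / eps + normalize (g y) i)); last first.
    by rewrite lerD2l le_maxmass.
  rewrite -lerBlDr.
  have : (normalize (f x) i - normalize (g y) i) ^+ 2 <= H.
    rewrite /H (bigD1 i)//= lerDl; apply: sumr_ge0 => j _; exact: sqr_ge0.
  move: (_ - _) => z zH.
  rewrite -(ler_pM2r e0) mulrDl divfK ?gt_eqF//.
  by have := sqr_ge0 (z - eps); nra.
under eq_bigr do rewrite !big_split/=.
rewrite !big_split/=.
have -> : \sum_x \sum_y eps * (D x y * mass (f x)) = eps * \sum_x mass (f x).
  rewrite -(sum_degrade (fun x => mass (f x)) DS) mulr_sumr.
  by apply: eq_bigr => x _; rewrite mulr_sumr.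
rewrite mulr_suml; under [X in _ <= _ + X + _]eq_bigr do rewrite mulr_suml.
rewrite lerD2l.
rewrite exchange_big/=; apply: ler_sum => y _.
by rewrite -mulr_suml -mass_degrade maxmass_normalize.
Qed.

End MaxMass.

(** * Random variables with finitely many values *)

Section FiniteVariables.
Context {R : realType} {disp : measure_display} {T : measurableType disp}
  (P : probability T R).

Lemma measure_partition (F : finType) (Z : T -> F) (A : set T) :
  measurable A -> (forall z, measurable [set w | Z w = z]) ->
  P A = (\sum_z P (A `&` [set w | Z w = z]))%E.
Proof.
move=> mA mZ.
have mAZ z : measurable (A `&` [set w | Z w = z]) by exact: measurableI.
transitivity (\int[P]_w (\1_A w)%:E)%E; first by rewrite integral_indic// setIT.
transitivity (\int[P]_w (\sum_z (\1_(A `&` [set w | Z w = z]) w)%:E))%E.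
  apply: eq_integral => w _; rewrite sumEFin; congr EFin.
  rewrite (bigD1 (Z w))//= big1 ?addr0.
    rewrite !indicE; case: (pselect (A w)) => Aw; first by rewrite !mem_set.
    by rewrite !memNset//= => -[].
  move=> z zZ; rewrite indicE memNset//= => -[_ Zz]; move: zZ.
  by rewrite Zz eqxx.
rewrite ge0_integral_sum//.
- by apply: eq_bigr => z _; rewrite integral_indic// setIT.
- move=> z; apply/measurable_EFinP; exact: measurable_indic.
Qed.

Lemma integral_finite (F : finType) (Z : T -> F) (h : F -> R) :
  (forall z, measurable [set w | Z w = z]) -> (forall z, 0 <= h z) ->
  (\int[P]_w (h (Z w))%:E = \sum_z (h z)%:E * P [set w | Z w = z])%E.
Proof.
move=> mZ h0.
transitivity (\int[P]_w (\sum_z (h z * \1_([set w | Z w = z]) w)%:E))%E.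
  apply: eq_integral => w _; rewrite sumEFin; congr EFin.
  rewrite (bigD1 (Z w))//= big1 ?addr0; first by rewrite indicE mem_set// mulr1.
  move=> z zZ; rewrite indicE memNset ?mulr0//= => Zz; move: zZ.
  by rewrite Zz eqxx.
rewrite ge0_integral_sum//.
- apply: eq_bigr => z _.
  rewrite (integralZl_indic measurableT (fun=> [set w | Z w = z]))//.
    by rewrite integral_indic// setIT.
  by move=> h_lt0; have := h0 z; rewrite leNgt h_lt0.
- move=> z; apply/measurable_EFinP; exact: measurable_funM.
- by move=> z w _; rewrite lee_fin mulr_ge0.
Qed.

(** The success probability depends only on the joint law of the hidden and the
    observed variable. *)
Lemma recoveryE (q : nat) (F : finType) (Y : T -> 'I_q) (Z : T -> F)
    (mu : F -> 'I_q -> R) :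
  (forall i, measurable [set w | Y w = i]) ->
  (forall z, measurable [set w | Z w = z]) ->
  (forall i z, P [set w | Y w = i /\ Z w = z] = (mu z i)%:E) ->
  recovery P Y Z = (\sum_z maxmass (mu z))%:E.
Proof.
move=> mY mZ law.
have mu0 z : nonneg (mu z) by move=> i; rewrite -lee_fin -law.
have PZ z : P [set w | Z w = z] = (mass (mu z))%:E.
  rewrite (measure_partition (Z := Y))// /mass -sumEFin.
  by apply: eq_bigr => i _; rewrite -law setIC.
rewrite /recovery unlock.
pose h z := maxmass (normalize (mu z)).
transitivity (\int[P]_w (h (Z w))%:E)%E.
  apply: eq_integral => w _; congr EFin; apply: eq_bigr => i _.
  by rewrite /posterior law PZ.
rewrite integral_finite//; last by move=> z; exact: maxmass_ge0.
rewrite -sumEFin; apply: eq_bigr => z _.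
by rewrite PZ -EFinM mulrC maxmass_normalize.
Qed.

End FiniteVariables.

(** * The law of the broadcast process *)

Section SetLevel.
Context {d q : nat}.

Definition set_level k (x : {ffun k.-tuple 'I_d -> 'I_q}) (s : seq 'I_d -> 'I_q) u :=
  if insub u is Some u' then x u' else s u.

Lemma set_level_tuple k (x : {ffun k.-tuple 'I_d -> 'I_q}) s (u : k.-tuple 'I_d) :
  set_level x s u = x u.
Proof. by rewrite /set_level valK. Qed.

Lemma set_level_neq k (x : {ffun k.-tuple 'I_d -> 'I_q}) s (u : seq 'I_d) :
  size u != k -> set_level x s u = s u.
Proof. by move=> /negbTE uk; rewrite /set_level insubF. Qed.

End SetLevel.

Section ProcessLaw.
Context {R : realType} {disp : measure_display} {T : measurableType disp}
  {P : probability T R} {q d : nat} {p : R} {Delta : 'M[R]_q}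
  {sigma tau : seq 'I_d -> T -> 'I_q}.
Context (q2 : (2 <= q)%N) (Delta1 : forall i, \sum_j Delta i j = 1).
Context (B : broadcast P p Delta sigma tau).

Local Notation lam := (potts_eigenvalue q p).

(** The leaf itself is observed, without noise. *)
Definition root_leaf (a i : 'I_q) : R := (a == i)%:R.

Definition offspring_kernel (a : 'I_q) (b : {ffun 'I_d -> 'I_q}) : R :=
  \prod_c potts_kernel p a (b c).

Lemma edge_root_leaf (i j : 'I_q) : edge lam (root_leaf j) i = potts_kernel p i j.
Proof.
have qn : q%:R - 1 != 0 :> R by rewrite subr_eq0 pnatr_eq1 gtn_eqF.
have q0 : q%:R != 0 :> R by rewrite pnatr_eq0 -lt0n (leq_trans _ q2).
rewrite /edge /root_leaf /mass /potts_kernel eq_sym.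
rewrite (bigD1 j)//= eqxx big1 ?addr0; last first.
  by move=> k kj; rewrite eq_sym (negbTE kj).
rewrite /potts_eigenvalue; case: (i == j) => /=; field; exact/andP.
Qed.

Lemma offspring_root_leaf :
  offspring lam root_leaf = degrade offspring_kernel root_leaf.
Proof.
apply/funext => b; apply/funext => i; rewrite /offspring /degrade /offspring_kernel.
rewrite [RHS](bigD1 i)//= {2}/root_leaf eqxx mulr1 [X in _ + X]big1 ?addr0; last first.
  by move=> a ai; rewrite /root_leaf (negbTE ai) mulr0.
by apply: eq_bigr => c _; rewrite edge_root_leaf.
Qed.

(** Seen from the root, level [m + 1] is drawn from level [m] by a Markov kernel. *)
Lemma level_law_root_leafS m (x : {ffun m.+1.-tuple 'I_d -> 'I_q}) :
  level_law lam root_leaf x =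
  degrade (leafwise offspring_kernel) (level_law lam root_leaf (m := m))
    (curry_ffun (@rcons_tuple m 'I_d) x).
Proof. by rewrite level_law_offspring offspring_root_leaf level_law_degrade. Qed.

Let below (i : 'I_q) k n (s t : seq 'I_d -> 'I_q) : set T :=
  [set w | sigma [::] w = i /\
     forall u, (k <= size u <= n)%N -> sigma u w = s u /\ tau u w = t u].

Let restrict (s : seq 'I_d -> 'I_q) k : {ffun k.-tuple 'I_d -> 'I_q} :=
  [ffun u : k.-tuple 'I_d => s u].

Let edges (s : seq 'I_d -> 'I_q) l : R :=
  \prod_(u : l.-tuple 'I_d) \prod_(c < d) potts_kernel p (s u) (s (rcons u c)).

Let noise (s t : seq 'I_d -> 'I_q) l : R :=
  \prod_(u : l.-tuple 'I_d) Delta (s u) (t u).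

Lemma measurable_level (lab : seq 'I_d -> T -> 'I_q) m x :
  (forall u i, measurable [set w | lab u w = i]) ->
  measurable [set w | level lab m w = x].
Proof.
move=> mlab; rewrite (_ : mkset _ =
    \bigcap_(u in [set: m.-tuple 'I_d]) [set w | lab u w = x u]).
  by apply: fin_bigcap_measurable => // u _; exact: mlab.
apply/seteqP; split => [w <- u _|w wx]; first by rewrite /= ffunE.
by apply/ffunP => u; rewrite ffunE; exact: wx.
Qed.

Let measurable_below i k n s t : measurable (below i k n s t).
Proof.
rewrite (_ : below i k n s t = [set w | sigma [::] w = i] `&`
  \bigcap_(l in [set l | (k <= l <= n)%N])
    ([set w | level sigma l w = restrict s l] `&`
     [set w | level tau l w = restrict t l])).
  apply: measurableI; first exact: (label_measurable B).
  apply: bigcap_measurableType => l _; apply: measurableI; apply: measurable_level.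
    exact: (label_measurable B).
  exact: (noisy_measurable B).
apply/seteqP; split => w [wi H]; split => //.
  move=> l/= ln; split; apply/ffunP => u; rewrite !ffunE;
    by case: (H u) => //; rewrite size_tuple.
move=> u un; have [/ffunP Hs /ffunP Ht] := H _ un.
by have := Hs (in_tuple u); have := Ht (in_tuple u); rewrite !ffunE.
Qed.

(** Induction on [k]: for [k = 0] this is the cylinder formula, and the step sums over
    the labels of level [k].  The noise of that level sums to 1, and its labels
    together with the edges to level [k + 1] give [level_law] there. *)
Let below_law i k n s t : (k <= n)%N ->
  P (below i k n s t) =
  (q%:R^-1 * level_law lam root_leaf (restrict s k) i
   * (\prod_(k <= l < n) edges s l) * \prod_(k <= l < n.+1) noise s t l)%:E.
Proof.
elim: k s t => [|k IH] s t kn.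
  rewrite /= /restrict ffunE /root_leaf/= !big_mkord.
  have [<-|si] := eqVneq (s [::]) i.
    rewrite mulr1 -(broadcast_law B); congr (P _); apply/seteqP; split => w.
      by move=> [_ H] u un; exact: H.
    by move=> H; split => [|u]; [case: (H [::])|exact: H].
  rewrite mulr0 !mul0r; transitivity (P set0); last by rewrite measure0.
  congr (P _); apply/seteqP; split => w//.
  by move=> [wi /(_ [::])[]// ws]; move/eqP: si; rewrite -ws wi.
pose Z w := (level sigma k w, level tau k w).
rewrite (measure_partition P (Z := Z) (measurable_below i k.+1 n s t)); last first.
  move=> [x y]; rewrite (_ : mkset _ = [set w | level sigma k w = x] `&`
     [set w | level tau k w = y]).
    by apply: measurableI; apply: measurable_level;
       [exact: (label_measurable B)|exact: (noisy_measurable B)].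
  by apply/seteqP; split => w; [case|case=> /= <- <-].
have beE x y : below i k.+1 n s t `&` [set w | Z w = (x, y)] =
    below i k n (set_level x s) (set_level y t).
  apply/seteqP; split => w.
    move=> [[wi H] [<- <-]]; split => // u un.
    have [uk|uk] := eqVneq (size u) k.
      move: un; rewrite -{}uk => _.
      have := set_level_tuple (level sigma (size u) w) s (in_tuple u).
      have := set_level_tuple (level tau (size u) w) t (in_tuple u).
      by rewrite /= => -> ->; rewrite !ffunE.
    by rewrite !set_level_neq//; apply: H; rewrite ltn_neqAle eq_sym uk.
  move=> [wi H]; split.
    split => // u /andP[ku un]; have := H u; rewrite un (ltnW ku) => /(_ isT).
    by rewrite !set_level_neq// gtn_eqF.
  congr pair; apply/ffunP => u; rewrite !ffunE;
    have := H u; rewrite size_tuple leqnn (ltnW kn) => /(_ isT)[Hs Ht];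
    by rewrite ?Hs ?Ht set_level_tuple.
have lawE x y : P (below i k.+1 n s t `&` [set w | Z w = (x, y)]) =
   ((leafwise Delta x y * (leafwise offspring_kernel x
       (curry_ffun (@rcons_tuple k 'I_d) (restrict s k.+1))
       * level_law lam root_leaf x i)) * (q%:R^-1 *
    (\prod_(k.+1 <= l < n) edges s l) * \prod_(k.+1 <= l < n.+1) noise s t l))%:E.
  rewrite beE IH ?(ltnW kn)//.
  have -> : restrict (set_level x s) k = x.
    by apply/ffunP => u; rewrite ffunE set_level_tuple.
  rewrite (big_ltn kn) (big_ltn (ltnW kn : (k < n.+1)%N)).
  have -> : edges (set_level x s) k = leafwise offspring_kernel x
       (curry_ffun (@rcons_tuple k 'I_d) (restrict s k.+1)).
    apply: eq_bigr => u _; apply: eq_bigr => c _.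
    rewrite set_level_tuple set_level_neq ?size_rcons ?size_tuple ?gtn_eqF//.
    by rewrite !ffunE.
  have -> : noise (set_level x s) (set_level y t) k = leafwise Delta x y.
    by apply: eq_bigr => u _; rewrite !set_level_tuple.
  have -> : \prod_(k.+1 <= l < n) edges (set_level x s) l =
            \prod_(k.+1 <= l < n) edges s l.
    apply: eq_big_nat => l /andP[kl _]; apply: eq_bigr => u _.
    apply: eq_bigr => c _.
    by rewrite !set_level_neq ?size_rcons ?size_tuple// gtn_eqF// ltnW.
  have -> : \prod_(k.+1 <= l < n.+1) noise (set_level x s) (set_level y t) l =
            \prod_(k.+1 <= l < n.+1) noise s t l.
    apply: eq_big_nat => l /andP[kl _]; apply: eq_bigr => u _.
    by rewrite !set_level_neq ?size_tuple// gtn_eqF.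
  by congr EFin; ring.
transitivity (\sum_(z : {ffun k.-tuple 'I_d -> 'I_q} * {ffun k.-tuple 'I_d -> 'I_q})
   (leafwise Delta z.1 z.2 * (leafwise offspring_kernel z.1
       (curry_ffun (@rcons_tuple k 'I_d) (restrict s k.+1))
       * level_law lam root_leaf z.1 i) * (q%:R^-1 *
    (\prod_(k.+1 <= l < n) edges s l) * \prod_(k.+1 <= l < n.+1) noise s t l))%:E)%E.
  by apply: eq_bigr => -[x y] _; exact: lawE.
rewrite sumEFin level_law_root_leafS; congr EFin; rewrite -mulr_suml.
rewrite -(pair_bigA _ (fun x y => leafwise Delta x y * (leafwise offspring_kernel x
       (curry_ffun (@rcons_tuple k 'I_d) (restrict s k.+1))
       * level_law lam root_leaf x i)))/=.
rewrite /degrade.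
under eq_bigr => x _.
  rewrite -mulr_suml (_ : \sum_y leafwise Delta x y = 1) ?mul1r; last first.
    rewrite /leafwise -(bigA_distr_bigA (fun u b => Delta (x u) b)) big1//.
  over.
ring.
Qed.

Lemma joint_law n i x y :
  P [set w | sigma [::] w = i /\ (level sigma n w = x /\ level tau n w = y)] =
  (q%:R^-1 * (level_law lam root_leaf x i * leafwise Delta x y))%:E.
Proof.
have := below_law i (set_level x (fun=> i)) (set_level y (fun=> i)) (leqnn n).
have rE z : restrict (set_level z (fun=> i)) n = z.
  by apply/ffunP => u; rewrite ffunE set_level_tuple.
rewrite rE big_geq// mulr1 big_nat1.
have -> : noise (set_level x (fun=> i)) (set_level y (fun=> i)) n = leafwise Delta x y.
  by apply: eq_bigr => u _; rewrite !set_level_tuple.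
rewrite -mulrA => <-; congr (P _); apply/seteqP; split => w [wi].
  move=> [<- <-]; split => // u; rewrite -eqn_leq => /eqP nu; subst n.
  have := set_level_tuple (level sigma (size u) w) (fun=> i) (in_tuple u).
  have := set_level_tuple (level tau (size u) w) (fun=> i) (in_tuple u).
  by rewrite /= => -> ->; rewrite !ffunE.
move=> H; split => //; split; apply/ffunP => u; rewrite ffunE;
  have := H u; rewrite size_tuple leqnn => /(_ isT)[Hs Ht];
  by rewrite ?Hs ?Ht set_level_tuple.
Qed.

Let mlabel u i : measurable [set w | sigma u w = i].
Proof. exact: (label_measurable B). Qed.

Let mnoisy u i : measurable [set w | tau u w = i].
Proof. exact: (noisy_measurable B). Qed.

Lemma label_law n i x :
  P [set w | sigma [::] w = i /\ level sigma n w = x] =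
  (q%:R^-1 * level_law lam root_leaf x i)%:E.
Proof.
rewrite (measure_partition P (Z := level tau n)); first last.
- by move=> y; exact: measurable_level.
- exact: measurableI (mlabel _ _) (measurable_level x mlabel).
under eq_bigr => y _.
  rewrite (_ : _ `&` _ = [set w | sigma [::] w = i /\
    (level sigma n w = x /\ level tau n w = y)]); last first.
    by apply/seteqP; split => w /=; tauto.
  rewrite joint_law mulrA; over.
rewrite sumEFin -mulr_sumr [X in _ * X](_ : _ = 1) ?mulr1//.
by rewrite /leafwise -(bigA_distr_bigA (fun u b => Delta (x u) b)) big1.
Qed.

Lemma noisy_law n i y :
  P [set w | sigma [::] w = i /\ level tau n w = y] =
  (q%:R^-1 * level_law lam (degrade Delta root_leaf) y i)%:E.
Proof.
rewrite (measure_partition P (Z := level sigma n)); first last.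
- by move=> x; exact: measurable_level.
- exact: measurableI (mlabel _ _) (measurable_level y mnoisy).
under eq_bigr => x _.
  rewrite (_ : _ `&` _ = [set w | sigma [::] w = i /\
    (level sigma n w = x /\ level tau n w = y)]); last first.
    by apply/seteqP; split => w /=; tauto.
  rewrite joint_law; over.
rewrite sumEFin -mulr_sumr level_law_degrade /degrade; congr (_ * _)%:E.
by apply: eq_bigr => x _; rewrite mulrC.
Qed.

Lemma label_recoveryE m : level_recovery P sigma sigma m =
  (q%:R^-1 * \sum_(x : {ffun m.-tuple 'I_d -> 'I_q})
     maxmass (level_law lam root_leaf x))%:E.
Proof.
rewrite /level_recovery (recoveryE _ _ (@label_law m))//; last first.
  by move=> z; exact: measurable_level.
rewrite mulr_sumr; congr EFin; apply: eq_bigr => x _.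
by rewrite maxmass_scale// invr_ge0.
Qed.

Lemma noisy_recoveryE m : level_recovery P sigma tau m =
  (q%:R^-1 * \sum_(y : {ffun m.-tuple 'I_d -> 'I_q})
     maxmass (level_law lam (degrade Delta root_leaf) y))%:E.
Proof.
rewrite /level_recovery (recoveryE _ _ (@noisy_law m))//; last first.
  by move=> z; exact: measurable_level.
rewrite mulr_sumr; congr EFin; apply: eq_bigr => x _.
by rewrite maxmass_scale// invr_ge0.
Qed.

End ProcessLaw.

(** * The common limit *)

Section Conclusion.
Context {R : realType} {q : nat}.

(** The entries [i] and [j] alone contribute at least
    [2 * (1 - 2 / q) >= 2 / 3]. *)
Lemma l1_distance_noise (Delta : 'M[R]_q) i j : (3 <= q)%N ->
  (forall i j, 0 <= Delta i j) -> (forall i, \sum_j Delta i j = 1) ->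
  (forall i, 1 - q%:R^-1 <= Delta i i) -> i != j ->
  2 / 3 <= l1_distance (fun b i => Delta i b) i j.
Proof.
move=> q3 D0 D1 Dd ij.
have qV : q%:R^-1 <= 3^-1 :> R by 
  rewrite lef_pV2 ?posrE ?ltr0n ?ler_nat// (leq_trans _ q3).
have off a b : a != b -> Delta a b <= q%:R^-1.
  move=> ab; have := Dd a; have := D1 a; rewrite (bigD1 a)//= (bigD1 b) 1?eq_sym//=.
  have : 0 <= \sum_(k | (k != a) && (k != b)) Delta a k by apply: sumr_ge0.
  lra.
rewrite /l1_distance (bigD1 i)//= (bigD1 j) 1?eq_sym//=.
have s0 : 0 <= \sum_(k | (k != i) && (k != j)) `|Delta i k - Delta j k|.
  by apply: sumr_ge0.
have := off _ _ ij; have := off j i; rewrite eq_sym ij => /(_ isT).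
have := Dd i; have := Dd j.
have := ler_norm (Delta i i - Delta j i).
have := ler_norm (Delta j j - Delta i j); rewrite distrC.
lra.
Qed.

Lemma degrade_root_leaf (G : finType) (D : 'I_q -> G -> R) :
  degrade D root_leaf = fun b i => D i b.
Proof.
apply/funext => b; apply/funext => i; rewrite /degrade (bigD1 i)//= big1 => [|a ai].
  by rewrite /root_leaf eqxx mulr1 addr0.
by rewrite /root_leaf (negbTE ai) mulr0.
Qed.

Lemma stochastic_offspring_kernel d (p : R) : (2 <= q)%N -> 0 <= p <= 1 ->
  stochastic (@offspring_kernel R q d p).
Proof.
move=> q2 /andP[p0 p1].
have k0 (i j : 'I_q) : 0 <= potts_kernel p i j :> R.
  rewrite /potts_kernel; case: ifP => _; first by rewrite subr_ge0.
  by apply: divr_ge0 => //; rewrite subr_ge0 ler1n; exact: ltnW.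
split=> [a b|a]; first exact: prodr_ge0.
rewrite /offspring_kernel -(bigA_distr_bigA (fun c j => potts_kernel p a j)).
rewrite big1// => c _.
rewrite (bigD1 a)//= /potts_kernel eqxx.
rewrite (eq_bigr (fun=> p / (q%:R - 1))) => [|j ja]; last by rewrite eq_sym (negbTE ja).
have qE : q.-1%:R = q%:R - 1 :> R by rewrite -subn1 natrB// ltnW.
rewrite sumr_const cardC1 card_ord -[X in _ + X]mulr_natr qE.
by rewrite divfK ?subrK// subr_eq0 pnatr_eq1 gtn_eqF.
Qed.

End Conclusion.

Theorem mainTheorem1 (R : realType) (q : nat) (hq : (3 <= q)%N) :
  exists C : R,
    forall (d : nat) (p : R) (Delta : 'M[R]_q)
      (disp : measure_display) (T : measurableType disp) (P : probability T R)
      (sigma tau : seq 'I_d -> T -> 'I_q),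
      (1 <= d)%N ->
      0 <= p <= 1 ->
      0 <= potts_eigenvalue q p <= 1 ->
      noise_matrix Delta ->
      broadcast P p Delta sigma tau ->
      C < potts_eigenvalue q p ^+ 2 * d%:R ->
      [/\ cvgn (level_recovery P sigma sigma),
          cvgn (level_recovery P sigma tau)
        & limn (level_recovery P sigma sigma) =
          limn (level_recovery P sigma tau)].
Proof.
exists (threshold q%:R) => d p Delta disp T P sigma tau _ p01 l01 noisy B yC.
have q2 : (2 <= q)%N by exact: ltnW.
have q0 : (0 < q)%N by exact: ltnW.
have D0 i j : 0 <= Delta i j by case/andP: (noise_entry noisy i j).
have D1 := noise_row noisy.
set lam := potts_eigenvalue q p in l01 yC.
have DS : stochastic (fun a b => Delta a b) by split.
have leaf0 a : nonneg (root_leaf a : 'I_q -> R) by move=> i; rewrite /root_leaf ler0n.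
have leaf1 (i : 'I_q) : \sum_a (root_leaf a i : R) = 1.
  rewrite (bigD1 i)//= /root_leaf eqxx big1 ?addr0// => a ai.
  by rewrite (negbTE ai).
have Qp : 0 < q%:R^-1 :> R by rewrite invr_gt0 ltr0n.
have leafd (i j : 'I_q) : i != j ->
    2 / 3 <= l1_distance (root_leaf : 'I_q -> 'I_q -> R) i j.
  move=> ij; rewrite (_ : root_leaf = fun b i => (1%:M : 'M[R]_q) i b).
    apply: l1_distance_noise => //.
    - by move=> a b; rewrite mxE ler0n.
    - move=> a; rewrite (bigD1 a)//= mxE eqxx big1 ?addr0// => b ba.
      by rewrite mxE eq_sym (negbTE ba).
    - by move=> a; rewrite mxE eqxx gerBl ltW.
  by apply/funext => b; apply/funext => a; rewrite /root_leaf mxE eq_sym.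
have noised i j : i != j ->
    2 / 3 <= l1_distance (degrade (fun a b => Delta a b) root_leaf) i j.
  rewrite degrade_root_leaf; apply: l1_distance_noise => //.
  exact: noise_diag noisy.
have loss := sqmass_loss_cvg0 q0 l01 yC DS leaf0 leaf1 leafd noised.
pose a m : R := q%:R^-1 * \sum_(x : {ffun m.-tuple 'I_d -> 'I_q})
     maxmass (level_law lam root_leaf x).
pose b m : R := q%:R^-1 * \sum_(y : {ffun m.-tuple 'I_d -> 'I_q})
     maxmass (level_law lam (degrade (fun a b => Delta a b) root_leaf) y).
have -> : level_recovery P sigma sigma = EFin \o a.
  by apply/funext => m; rewrite (label_recoveryE q2 D1 B).
have -> : level_recovery P sigma tau = EFin \o b.
  by apply/funext => m; rewrite (noisy_recoveryE q2 D1 B).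
have lev0 m (x : {ffun m.-tuple 'I_d -> 'I_q}) : nonneg (level_law lam root_leaf x).
  exact: nonneg_level_law.
have ba m : b m <= a m.
  rewrite /a /b ler_pM2l// level_law_degrade; apply: maxmass_degrade => //.
  exact: stochastic_leafwise.
have aS m : a m.+1 <= a m.
  rewrite /a ler_pM2l//; under eq_bigr do rewrite level_law_root_leafS//.
  rewrite (sum_curry (fun z => maxmass (degrade (leafwise (@offspring_kernel R q d p))
    (level_law lam root_leaf (m := m)) z)) (rcons_tuple_bij m d)).
  apply: maxmass_degrade => //; exact/stochastic_leafwise/stochastic_offspring_kernel.
have acvg : cvgn a.
  apply: nonincreasing_is_cvgn; first exact/nonincreasing_seqP.
  exists 0 => _ [m _ <-]; apply: mulr_ge0; first exact: ltW.
  by apply: sumr_ge0 => x _; exact: maxmass_ge0.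
have ab : (fun m => a m - b m) @ \oo --> 0.
  apply/cvgrPdist_le => eps e0.
  have e2 : 0 < eps / 2 by rewrite divr_gt0.
  (* A loss of at most [(eps / 2) ^ 2] bounds both terms of [maxmass_gap] by
     [eps / 2], after division by [q]. *)
  move/cvgrPdist_le : loss => /(_ _ (exprn_gt0 2 e2)).
  apply: filterS => m; rewrite !sub0r !normrN => lm.
  rewrite ger0_norm ?subr_ge0//.
  have := maxmass_gap (stochastic_leafwise d m DS) (lev0 m) e2.
  rewrite -level_law_degrade -/(sqmass_loss d lam _ _ m).
  have -> : \sum_(x : {ffun m.-tuple 'I_d -> 'I_q}) 
      mass (level_law lam root_leaf x) = q%:R.
    rewrite /mass exchange_big/= (eq_bigr (fun=> 1)); last first.
      by move=> i _; exact: sum_level_law.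
    by rewrite sumr_const card_ord.
  move: lm; rewrite ger0_norm; last exact: sqmass_loss_ge0.
  rewrite /a /b -mulrBr => lm gap.
  rewrite ler_pdivrMl ?ltr0n//; apply: (le_trans gap).
  have Q1 : 1 <= q%:R :> R by rewrite ler1n.
  have : sqmass_loss d lam (fun a b => Delta a b) root_leaf m / (eps / 2) <= eps / 2.
    by rewrite ler_pdivrMr// -expr2.
  nra.
have bcvg : b @ \oo --> limn a.
  rewrite (_ : b = fun m => a m - (a m - b m)); last by apply/funext => m; ring.
  by rewrite -[limn a]subr0; apply: cvgB.
have A : (EFin \o a) @ \oo --> (limn a)%:E by apply: cvg_EFin => //; near=> m.
have B' : (EFin \o b) @ \oo --> (limn a)%:E by apply: cvg_EFin => //; near=> m.
split; [exact: cvgP A | exact: cvgP B' | ].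
by rewrite (cvg_lim _ A)// (cvg_lim _ B').
Unshelve. all: by end_near. Qed.
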